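(* Let $d\in\mathbb{N}$, $p$ a kernel and $\xi$ noise as in the context. Let $\{\eta_t\}_{t\in\mathbb{Z}_+}$ be an $(\mathbb{R}^d)^{\mathbb{Z}^d}$-valued process evolving by \[\eta_{t+1}(x-e_i,x)=\sum_z p(0,z)\eta_t(x+z-e_i,x+z)+\xi_{t+1}(x)-\xi_{t+1}(x-e_i),\] with $\{\xi_s\}_{s\ge 1}$ independent of $\eta_0$. Assume $\eta_0(x-e_i,x)=u_i(x)+\zeta(x,i)$ for $x\in\mathbb{Z}^d$, $i=1,\dots,d$, where $u=(u_1,\dots,u_d)\in\mathcal{H}_d$ and $\zeta=\{\zeta(x)\}_{x\in\mathbb{Z}^d}$, $\zeta(x)=(\zeta(x,i))_{i\le d}$, is an $(\mathbb{R}^d)^{\mathbb{Z}^d}$-valued random configuration whose distribution is invariant and ergodic under the spatial shift group $\{\theta_{x}\}_{x\in\mathbb{Z}^d}$ and with $E\zeta(x)=0$. Let $\mu_t$ be the distribution of $\eta_t$. Then $\mu_t\to\pi_u$ weakly as $t\to\infty$.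
   Context: The kernel $p:\mathbb{Z}^d\to[0,1)$ satisfies $\sum_x p(x)=1$, $p(x)=0$ for $|x|>M$ for some $M<\infty$, and strong aperiodicity: for every $u\in\mathbb{Z}^d$ the smallest additive subgroup of $\mathbb{Z}^d$ containing $\{u+x:p(x)>0\}$ is $\mathbb{Z}^d$; $p(x,y)=p(y-x)$, $p^k$ the $k$-step transition. $\xi=\{\xi_t(x)\}_{t\in\mathbb{Z},x\in\mathbb{Z}^d}$ are i.i.d. real, mean zero, finite variance. $\mathcal{H}_d$ is the set of $u=(u_1,\dots,u_d)$, $u_i:\mathbb{Z}^d\to\mathbb{R}$ with $\sum_y p(x,y)u_i(y)=u_i(x)$ for all $x$. $\Delta_0(x-e_i,x)=\sum_{k\ge 0}\sum_z\xi_{-k}(z)(p^k(x,z)-p^k(x-e_i,z))$, and $\pi_u$ is the law of $\{u_i(x)+\Delta_0(x-e_i,x)\}_{x,i}$. The spatial shift is $(\theta_a\zeta)(x)=\zeta(x+a)$. Weak convergence is of probability measures on $(\mathbb{R}^d)^{\mathbb{Z}^d}$ with the product topology. *)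

(* Defs.v *)
From HB Require Import structures.
From mathcomp Require Import all_boot all_order all_algebra.
From mathcomp Require Import all_classical all_reals all_analysis.
Set Implicit Arguments. Unset Strict Implicit. Unset Printing Implicit Defensive.
Import Order.TTheory GRing.Theory Num.Theory.
Import numFieldNormedType.Exports.
Local Open Scope classical_set_scope.
Local Open Scope ring_scope.

Definition site (d : nat) := 'rV[int]_d.
Definition unit_vec (d : nat) (i : 'I_d) : site d := delta_mx 0 i.

(* Configurations in (R^d)^{Z^d}: c (x, i) is the i-th component at site x,
   i.e. the value on the edge (x - e_i, x). *)
Definition cfg (R : realType) (d : nat) := site d * 'I_d -> R.

Definition fsum (R : realType) (d : nat) (f : site d -> R) : R :=
  \sum_(z \in [set: site d]) f z.

Definition site_norm (R : realType) (d : nat) (x : site d) : R :=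
  Num.sqrt (\sum_(j < d) ((x ord0 j)%:~R : R) ^+ 2).

Definition is_rw_kernel (R : realType) (d : nat) (p : site d -> R) : Prop :=
  (forall x, 0 <= p x /\ p x < 1) /\ fsum p = 1 /\
  (exists M : R, forall x, M < site_norm R x -> p x = 0).

Definition is_addsubgroup (d : nat) (G : set (site d)) : Prop :=
  G 0 /\ (forall x y, G x -> G y -> G (x - y)).

Definition generated_addsubgroup (d : nat) (S : set (site d)) : set (site d) :=
  [set y | forall G, is_addsubgroup G -> S `<=` G -> G y].

Definition strongly_aperiodic (R : realType) (d : nat) (p : site d -> R) : Prop :=
  forall u : site d,
    generated_addsubgroup [set u + x | x in [set x | 0 < p x]] = setT.

(* k-step kernel: pstep p k y = p^k(0, y), so p^k(x, z) = pstep p k (z - x). *)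
Fixpoint pstep (R : realType) (d : nat) (p : site d -> R) (k : nat) : site d -> R :=
  match k with
  | 0 => fun x => (x == 0)%:R
  | k'.+1 => fun x => fsum (fun y => pstep p k' y * p (x - y))
  end.

Definition p_harmonic (R : realType) (d : nat) (p : site d -> R)
  (u : 'I_d -> site d -> R) : Prop :=
  forall i x, fsum (fun y => p (y - x) * u i y) = u i x.

Definition mutually_independent (R : realType) (dO : measure_display)
  (O : measurableType dO) (P : probability O R) (I : eqType) (X : I -> O -> R) : Prop :=
  forall (s : seq I) (B : I -> set R), uniq s -> (forall j, measurable (B j)) ->
    P (\bigcap_(j in [set j | j \in s]) (X j @^-1` B j)) =
    (\prod_(j <- s) P (X j @^-1` B j))%E.

(* Independence of two families of real random variables (independence of the
   generated sigma-algebras, tested on the generating pi-systems). *)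
Definition independent_families (R : realType) (dO : measure_display)
  (O : measurableType dO) (P : probability O R) (I J : eqType)
  (X : I -> O -> R) (Y : J -> O -> R) : Prop :=
  forall (s : seq I) (s' : seq J) (B : I -> set R) (C : J -> set R),
    (forall j, measurable (B j)) -> (forall j, measurable (C j)) ->
    P ((\bigcap_(j in [set j | j \in s]) (X j @^-1` B j)) `&`
       (\bigcap_(j in [set j | j \in s']) (Y j @^-1` C j))) =
    (P (\bigcap_(j in [set j | j \in s]) (X j @^-1` B j)) *
     P (\bigcap_(j in [set j | j \in s']) (Y j @^-1` C j)))%E.

Definition iid_noise (R : realType) (d : nat) (dO : measure_display)
  (O : measurableType dO) (P : probability O R) (xi : int -> site d -> O -> R) : Prop :=
  (forall t x, measurable_fun setT (xi t x)) /\
  mutually_independent P (fun j : int * site d => xi j.1 j.2) /\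
  (forall t x s y B, measurable B ->
     P (xi t x @^-1` B) = P (xi s y @^-1` B)) /\
  (forall t x, P.-integrable setT (fun w => (xi t x w)%:E) /\
               (\int[P]_w (xi t x w)%:E = 0)%E /\
               P.-integrable setT (fun w => (xi t x w ^+ 2)%:E)).

Definition cylinder_events (R : realType) (d : nat) : set (set (cfg R d)) :=
  [set A | exists j (B : set R), measurable B /\ A = (fun c : cfg R d => c j) @^-1` B].

Definition cfg_measurable (R : realType) (d : nat) (A : set (cfg R d)) : Prop :=
  <<s @cylinder_events R d >> A.

Definition cfg_shift (R : realType) (d : nat) (a : site d) (c : cfg R d) : cfg R d :=
  fun j => c (j.1 + a, j.2).

Definition shift_invariant_law (R : realType) (d : nat) (dO : measure_display)
  (O : measurableType dO) (P : probability O R) (zeta : O -> cfg R d) : Prop :=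
  forall (a : site d) (A : set (cfg R d)), cfg_measurable A ->
    P (zeta @^-1` (cfg_shift a @^-1` A)) = P (zeta @^-1` A).

Definition shift_ergodic_law (R : realType) (d : nat) (dO : measure_display)
  (O : measurableType dO) (P : probability O R) (zeta : O -> cfg R d) : Prop :=
  forall A : set (cfg R d), cfg_measurable A ->
    (forall a : site d, cfg_shift a @^-1` A = A) ->
    P (zeta @^-1` A) = 0%E \/ P (zeta @^-1` A) = 1%E.

Definition Delta0 (R : realType) (d : nat) (p : site d -> R) (dO : measure_display)
  (O : measurableType dO) (xi : int -> site d -> O -> R) (w : O) : cfg R d :=
  fun j => limn (fun n : nat => \sum_(k < n)
     fsum (fun z => xi (- (k%:Z))%R z w *
                    (pstep p k (z - j.1) - pstep p k (z - (j.1 - unit_vec j.2))))).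

Definition weak_conv_laws (R : realType) (d : nat) (dO : measure_display)
  (O : measurableType dO) (P : probability O R)
  (X : nat -> O -> cfg R d) (Y : O -> cfg R d) : Prop :=
  forall f : {ptws (site d * 'I_d) -> R} -> R,
    continuous f -> (exists C : R, forall c, `|f c| <= C) ->
    (fun t => (\int[P]_w (f (X t w))%:E)%E) @ \oo --> (\int[P]_w (f (Y w))%:E)%E.

(* Main.v *)
(* Write A g (x) = sum_z p(z) g(x + z). Unfolding the recursion gives
   eta_t = u + A^t zeta + S_t, where S_t is a sum of increments of A^k xi_(t-k),
   k < t. Reversing time, S_t has the law of the t-th partial sum of Delta0, so
   it suffices that these partial sums converge almost surely, that A^t zeta
   tends to 0 in L1, and that bounded continuous functions on the product space
   are limits from below of Lipschitz functions of finitely many coordinates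
   (inf-convolution).

   Both limits rest on one energy identity: for a second-order stationary field
   Z, E(A Z(0))^2 = E Z(0)^2 - 1/2 sum_(x,y) p(x) p(y) E(Z(x) - Z(y))^2. It makes
   sum_k E(A^k Z(x) - A^k Z(y))^2 finite when p(x) p(y) > 0, and the set of
   differences x - y for which this sum is finite is a subgroup, hence all of
   Z^d by strong aperiodicity; no Fourier analysis is needed. For Z = xi this is
   the summability of the variances in Delta0, and Etemadi's inequality gives
   almost sure convergence. For Z a bounded centred function of zeta it shows
   that A^k Z is asymptotically shift invariant, so that it can be compared with
   small elements of the convex hull of the shifts of Z; these exist because a
   minimising sequence is Cauchy and its limit is invariant, hence 0 by
   ergodicity. *)

Require Import Defs.
From HB Require Import structures.
From mathcomp Require Import all_boot all_order all_algebra.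
From mathcomp Require Import all_classical all_reals all_analysis.
From mathcomp Require Import measurable_realfun.
From mathcomp Require Import ring lra.
Set Implicit Arguments. Unset Strict Implicit. Unset Printing Implicit Defensive.
Import Order.TTheory GRing.Theory Num.Theory.
Import numFieldNormedType.Exports.
Local Open Scope classical_set_scope.
Local Open Scope ring_scope.

(** * The averaging operator of the kernel *)

Section kernel.
Context {R : realType} {d : nat}.
Implicit Types (p : site d -> R) (s : seq (site d)) (x y z : site d).

(** [Delta0] is a pointwise limit, so L2 convergence of its partial sums does not identify it:
    almost sure convergence is required, hence a maximal inequality. The sums S_t agree in law with
    these partial sums only for each fixed t, so convergence is transferred through expectations of
    test functions, never pathwise. The energy identity is the variance formula for the weights p,
    integrated. The second moments of A^k Z(0) decrease and stay nonnegative, so the weighted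
    squared increments sum to at most 2 E Z(0)^2. Only stationarity of second moments enters, which
    lets one argument serve both the independent noise and the dependent field zeta. Since zeta is
    merely integrable, it is truncated and recentred before second moments are taken; the L1
    contraction of A keeps the truncation error uniform in k. Ergodicity speaks of events invariant
    as sets, so the almost surely invariant limit of the minimising sequence has to be turned into
    an exactly invariant event. *)

Lemma fsum_seq s (f : site d -> R) :
  uniq s -> (forall z, f z != 0 -> z \in s) -> fsum f = \sum_(z <- s) f z.
Proof.
move=> us fs; rewrite /fsum (fsbigE s)//=.
  by apply: eq_bigl => i; rewrite in_setT.
by move=> z _; apply: contraNeq => /fs.
Qed.

Lemma fsum_shift (f : site d -> R) y : fsum (fun z => f (z - y)) = fsum f.
Proof.
rewrite /fsum [RHS](reindex_fsbigT (fun z => z - y))//.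
by exists (fun z => z + y) => z; rewrite ?subrK ?addrK.
Qed.

(** The list is the exact support of [p], so membership yields [0 < p z], by which the energy bound
    is later divided. *)
Definition ker_on s p := [/\ uniq s, forall z, (z \in s) = (p z != 0),
  forall z, 0 <= p z & \sum_(z <- s) p z = 1].

(* [fsum] is 0 on functions of infinite support, so [fsum p = 1] already
   forces finite support. *)
Lemma rw_kernel_support p : is_rw_kernel p -> exists s, ker_on s p.
Proof.
case=> p01 [p1 _].
have pf : finite_set ([set: site d] `&` p @^-1` [set~ 0]).
  apply: contrapT => /(fsbig_dflt (GRing.add : Monoid.law (0:R))) h.
  by move: p1; rewrite /fsum h => /eqP; rewrite eq_sym oner_eq0.
exists (finite_support 0 [set: site d] p); split=> //.
- exact: finite_support_uniq.
- move=> z; rewrite in_finite_support//; apply/idP/idP.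
    by move/set_mem => [_ /eqP].
  by move=> /eqP h; apply/mem_set.
- by move=> z; have [] := p01 z.
Qed.

Definition avg s p (g : site d -> R) x := \sum_(z <- s) p z * g (x + z).

Lemma avgD s p g h x : avg s p (fun y => g y + h y) x = avg s p g x + avg s p h x.
Proof. by rewrite /avg -big_split; apply: eq_bigr => z _; rewrite mulrDr. Qed.

Lemma avgB s p g h x : avg s p (fun y => g y - h y) x = avg s p g x - avg s p h x.
Proof. by rewrite /avg -sumrB; apply: eq_bigr => z _; rewrite mulrBr. Qed.

Lemma avgZ s p a g x : avg s p (fun y => a * g y) x = a * avg s p g x.
Proof. by rewrite /avg mulr_sumr; apply: eq_bigr => z _; rewrite mulrCA. Qed.

Lemma avg_shift s p g a x : avg s p (fun y => g (y + a)) x = avg s p g (x + a).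
Proof. by apply: eq_bigr => z _; rewrite addrAC. Qed.

Lemma eq_iter_avg s p k g h : g =1 h -> iter k (avg s p) g =1 iter k (avg s p) h.
Proof. by move=> /funext ->. Qed.

Lemma iter_avgD s p k g h x :
  iter k (avg s p) (fun y => g y + h y) x = iter k (avg s p) g x + iter k (avg s p) h x.
Proof.
by elim: k x => //= k ih x; rewrite -avgD; apply: eq_bigr => z _; rewrite ih.
Qed.

Lemma iter_avgZ s p k a g x :
  iter k (avg s p) (fun y => a * g y) x = a * iter k (avg s p) g x.
Proof.
by elim: k x => //= k ih x; rewrite -avgZ; apply: eq_bigr => z _; rewrite ih.
Qed.

Lemma iter_avg_shift s p k g a x :
  iter k (avg s p) (fun y => g (y + a)) x = iter k (avg s p) g (x + a).
Proof.
by elim: k x => //= k ih x; rewrite -avg_shift; apply: eq_bigr => z _; rewrite ih.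
Qed.

Lemma iter_avg_cst s p k c x : ker_on s p -> iter k (avg s p) (fun=> c) x = c.
Proof.
case=> _ _ _ s1; elim: k x => //= k ih x.
rewrite /avg; under eq_bigr do rewrite ih.
by rewrite -mulr_suml s1 mul1r.
Qed.

Lemma fsum_avg s p g x : ker_on s p -> fsum (fun z => p z * g (x + z)) = avg s p g x.
Proof.
case=> us sp _ _; apply: fsum_seq => // z /=; rewrite sp.
by apply: contraNneq => ->; rewrite mul0r.
Qed.

(** The recursion of [pstep] goes through [fsum], which is meaningful only for finite support; a
    finite list carrying p^k is therefore built along the induction. A superset of the support is
    enough. *)
Lemma pstep_iter_avg s p k : ker_on s p ->
  exists2 sk : seq (site d), uniq sk &
    (forall z, pstep p k z != 0 -> z \in sk) /\
    forall g x, \sum_(z <- sk) pstep p k z * g (x + z) = iter k (avg s p) g x.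
Proof.
move=> Hp; have [us sp _ _] := Hp; elim: k => [|k [sk usk [sk0 IH]]].
  exists [:: 0] => //; split=> [z /=|g x].
    by rewrite inE; case: (z == 0) => //; rewrite eqxx.
  by rewrite big_seq1 /= eqxx mul1r addr0.
pose sk1 := undup [seq y + z | y <- sk, z <- s].
have pS z : pstep p k.+1 z = \sum_(y <- sk) pstep p k y * p (z - y).
  rewrite -[LHS]/(fsum (fun y => pstep p k y * p (z - y))).
  apply: fsum_seq => // y h.
  by apply: sk0; apply: contraNneq h => ->; rewrite mul0r.
have hz y z : pstep p k y * p z != 0 -> y + z \in sk1.
  move=> h; rewrite mem_undup; apply: allpairs_f; last rewrite sp.
    by apply: sk0; apply: contraNneq h => ->; rewrite mul0r.
  by apply: contraNneq h => ->; rewrite mulr0.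
have usk1 : uniq sk1 by exact: undup_uniq.
exists sk1 => //; split=> [z|g x].
  apply: contraNT => nz; rewrite pS big1_seq// => y /= ys; apply/eqP.
  by apply: contraNT nz => /hz; rewrite addrC subrK.
(* [pstep] appends its new step on the right, so one average is moved inside and the induction
   hypothesis is used for [avg s p g]. *)
rewrite iterSr -IH; under [LHS]eq_bigr do rewrite pS mulr_suml.
rewrite exchange_big/=; apply: eq_big_seq => y ys.
transitivity (fsum (fun z => pstep p k y * p (z - y) * g (x + z))).
  rewrite (fsum_seq usk1)// => z /= nz0; rewrite -[z](subrK y) addrC; apply: hz.
  by apply: contraNneq nz0 => ->; rewrite mul0r.
rewrite -(fsum_shift _ (- y)) -fsum_avg//.
rewrite (_ : (fun _ => _) = (fun z => pstep p k y * (p z * g (x + y + z)))); last first.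
  by apply/funext => z; rewrite opprK addrK mulrA (addrC z) addrA.
rewrite (fsum_seq us); last first.
  by move=> z /=; rewrite sp; apply: contraNneq => ->; rewrite mul0r mulr0.
rewrite -mulr_sumr (fsum_seq us)//.
by move=> z /=; rewrite sp; apply: contraNneq => ->; rewrite mul0r.
Qed.

Lemma fsum_pstep s p k g x : ker_on s p ->
  fsum (fun z => g z * pstep p k (z - x)) = iter k (avg s p) g x.
Proof.
move=> /(pstep_iter_avg k)[sk usk [sk0 <-]].
rewrite -(fsum_shift _ (- x)) (fsum_seq usk).
  by apply: eq_bigr => z _; rewrite opprK addrK mulrC addrC.
by move=> z; rewrite /= opprK addrK => h; apply: sk0; apply: contraNneq h => ->; rewrite mulr0.
Qed.

(** Additivity of [fsum] needs finite supports, so both kernels are placed on one common list [r]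
    before splitting. *)
Lemma fsum_pstepB s p k g x y : ker_on s p ->
  fsum (fun z => g z * (pstep p k (z - x) - pstep p k (z - y))) =
  iter k (avg s p) g x - iter k (avg s p) g y.
Proof.
move=> Hp; have [sk usk [sk0 _]] := pstep_iter_avg k Hp.
rewrite -!(fsum_pstep k _ _ Hp).
pose r := undup ([seq z + x | z <- sk] ++ [seq z + y | z <- sk]).
have hr : uniq r by exact: undup_uniq.
have hx z : pstep p k (z - x) != 0 -> z \in r.
  move=> /sk0 h; rewrite mem_undup mem_cat; apply/orP; left.
  by apply/mapP; exists (z - x); rewrite ?subrK.
have hy z : pstep p k (z - y) != 0 -> z \in r.
  move=> /sk0 h; rewrite mem_undup mem_cat; apply/orP; right.
  by apply/mapP; exists (z - y); rewrite ?subrK.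
rewrite !(fsum_seq hr); first by rewrite -sumrB; apply: eq_bigr => z _; rewrite mulrBr.
- by move=> z /= h; apply: hy; apply: contraNneq h => ->; rewrite mulr0.
- by move=> z /= h; apply: hx; apply: contraNneq h => ->; rewrite mulr0.
- move=> z /= h; have [e|/hx//] := eqVneq (pstep p k (z - x)) 0.
  by apply: hy; apply: contraNneq h => e'; rewrite e e' subrr mulr0.
Qed.

(* Strong aperiodicity is used only through this consequence: the differences
   of points of the support generate the lattice. *)
Lemma aperiodic_ind s p (G : set (site d)) :
  ker_on s p -> strongly_aperiodic p -> is_addsubgroup G ->
  (forall x y, x \in s -> y \in s -> G (x - y)) -> forall x, G x.
Proof.
move=> [us sp p0 p1] ap sG Gs x.
have [x0 x0s] : exists x0, x0 \in s.
  case: s p1 {us sp Gs} => [|x0 s _]; last by exists x0; rewrite mem_head.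
  by rewrite big_nil => /eqP; rewrite eq_sym oner_eq0.
have : [set: site d] x by [].
(* Strong aperiodicity at u = -x0 turns the translated support into differences y - x0 of support
   points. *)
rewrite -(ap (- x0)); apply=> // _ [y /= py <-].
by rewrite addrC; apply: Gs => //; rewrite sp gt_eqF.
Qed.

End kernel.

(** * Laws and independence of families *)

Section rectangles.
Context {R : realType}.

(** Generators of the sigma-algebra of a family. For the coordinate maps of [cfg] this is
    convertible to [cylinder_events], so [cfg_measurable] is measurability in the type built from
    it. *)
Definition coord_events {T : Type} {I : Type} (X : I -> T -> R) : set (set T) :=
  [set A | exists j (B : set R), measurable B /\ A = X j @^-1` B].

Definition rect {T : Type} {I : eqType} (X : I -> T -> R) (s : seq I)
  (B : I -> set R) : set T := \bigcap_(j in [set j | j \in s]) (X j @^-1` B j).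

Lemma rect_cat (T : Type) (I : eqType) (X : I -> T -> R) s s' B :
  rect X (s ++ s') B = rect X s B `&` rect X s' B.
Proof.
rewrite /rect -bigcap_setU; congr bigcap; apply/seteqP; split=> j /=;
  by rewrite mem_cat => /orP.
Qed.

Lemma eq_rect_fam (T : Type) (I : eqType) (X : I -> T -> R) s B B' :
  (forall j, j \in s -> B j = B' j) -> rect X s B = rect X s B'.
Proof. by move=> e; apply: eq_bigcapr => j /= /e ->. Qed.

Lemma rect_map (T : Type) (I J : eqType) (X : I -> T -> R) (h : J -> I) s B :
  rect X (map h s) B = rect (X \o h) s (B \o h).
Proof.
apply/seteqP; split=> w hw j /=.
  by move=> js; apply: hw => /=; rewrite map_f.
by move=> /mapP[i iS ->]; exact: hw.
Qed.

Lemma rect_sigma (T : pointedType) (I : eqType) (X : I -> T -> R) s B :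
  (forall j, measurable (B j)) -> <<s coord_events X >> (rect X s B).
Proof.
move=> mB; elim: s => [|j s IH].
  have -> : rect X [::] B = ~` set0 by rewrite setC0; apply/seteqP; split.
  by apply: sigma_algebraC; exact: sigma_algebra0.
rewrite (rect_cat X [:: j] s); have -> : rect X [:: j] B = X j @^-1` B j.
  apply/seteqP; split=> w; first by move/(_ j); apply=> /=; rewrite mem_head.
  by move=> hw i /=; rewrite inE => /eqP ->.
rewrite -[X in <<s _ >> X]setCK setCI -bigcup2E.
apply: sigma_algebraC; apply: sigma_algebra_bigcup => -[|[|n]] /=.
- by apply: sigma_algebraC; apply: sub_sigma_algebra; exists j, (B j).
- exact: sigma_algebraC.
- exact: sigma_algebra0.
Qed.

(* Rectangles form a pi-system generating the sigma-algebra of a family. *)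
Lemma rect_measure_unique d (T : measurableType d) (I : eqType) (X : I -> T -> R)
    (m1 m2 : {measure set T -> \bar R}) :
  (forall j, measurable_fun setT (X j)) -> (m1 setT < +oo)%E ->
  (forall s B, uniq s -> (forall j, measurable (B j)) ->
     m1 (rect X s B) = m2 (rect X s B)) ->
  forall A, <<s coord_events X >> A -> m1 A = m2 A.
Proof.
move=> mX m1oo m12 A sA.
pose G := [set A | exists s B, [/\ uniq s, forall j, measurable (B j) &
  A = rect X s B]].
have rT : rect X [::] (fun=> setT) = setT by apply/seteqP; split.
apply: (@g_sigma_algebra_measure_unique _ R T G _ (fun=> setT)) => //.
- move=> _ [s [B [_ mB ->]]].
  rewrite /rect; elim: s => [|j s IH].
    by rewrite (_ : bigcap _ _ = setT)//; apply/seteqP; split.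
  have := rect_cat X [:: j] s B; rewrite /rect => ->; apply: measurableI => //.
  rewrite (_ : bigcap _ _ = X j @^-1` B j).
    by rewrite -[X in measurable X]setTI; exact: mX.
  apply/seteqP; split=> w; first by move/(_ j); apply=> /=; rewrite mem_head.
  by move=> hw i /=; rewrite inE => /eqP ->.
- by move=> _; exists [::], (fun=> setT); split.
- by rewrite bigcup_const//; exists 0%N.
- move=> _ _ [s [B [us mB ->]]] [s' [B' [us' mB' ->]]].
  exists (undup (s ++ s')), (fun j => (if j \in s then B j else setT) `&`
    (if j \in s' then B' j else setT)); split.
  + exact: undup_uniq.
  + by move=> j; apply: measurableI; case: ifP.
  + apply/seteqP; split=> w.
      move=> [h h'] j /= _; split.
        by case: ifPn => // js; exact: h.
      by case: ifPn => // js; exact: h'.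
    move=> h; split=> j /= js; have := h j; rewrite /= mem_undup mem_cat js ?orbT.
      by case=> // + _.
    by case=> // _.
- by move=> _ [s [B [us mB ->]]]; exact: m12.
- apply: sub_sigma_algebra2 sA => _ [j [B [mB ->]]].
  exists [:: j], (fun=> B); split=> //; apply/seteqP; split=> w.
    by move=> h i /=; rewrite inE => /eqP ->.
  by move/(_ j); apply=> /=; rewrite mem_head.
Qed.

Lemma sigma_measurable d (T : measurableType d) (I : Type) (X : I -> T -> R) A :
  (forall j, measurable_fun setT (X j)) -> <<s coord_events X >> A -> measurable A.
Proof.
move=> mX; apply: smallest_sub; first exact: sigma_algebra_measurable.
by move=> _ [j [B [mB ->]]]; rewrite -[X in measurable X]setTI; exact: mX.
Qed.

End rectangles.

Section laws.
Context {R : realType} {dO : measure_display} {O : measurableType dO}.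
Variable P : probability O R.

Notation cfgspace I :=
  (g_sigma_algebraType (coord_events (fun (j : I) (c : I -> R) => c j))).

Lemma measurable_family (I : Type) (X : I -> O -> R) :
  (forall j, measurable_fun setT (X j)) ->
  measurable_fun setT ((fun w j => X j w) : O -> cfgspace I).
Proof.
move=> mX; apply: (@measurability _ _ O (cfgspace I) setT _
  (coord_events (fun (j : I) (c : I -> R) => c j))) => //.
move=> _ [_ [j [B [mB ->]]] <-].
exact: mX.
Qed.

Lemma measurable_coord (I : Type) (j : I) :
  measurable_fun setT ((fun c => c j) : cfgspace I -> R).
Proof.
by move=> _ B mB; rewrite setTI; apply: sub_sigma_algebra; exists j, B.
Qed.

(** Both families are pushed forward to the product space, where the rectangles determine a finite
    measure. *)
Lemma same_law (I : eqType) (X Y : I -> O -> R) :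
  (forall j, measurable_fun setT (X j)) -> (forall j, measurable_fun setT (Y j)) ->
  (forall s B, uniq s -> (forall j, measurable (B j)) ->
     P (rect X s B) = P (rect Y s B)) ->
  forall A : set (cfgspace I), measurable A ->
    P ((fun w j => X j w) @^-1` A) = P ((fun w j => Y j w) @^-1` A).
Proof.
move=> mX mY XY A mA.
have mX' := measurable_family mX; have mY' := measurable_family mY.
pose fX : {mfun O >-> cfgspace I} := HB.pack (fun w j => X j w)
  (isMeasurableFun.Build _ _ _ _ _ mX').
pose fY : {mfun O >-> cfgspace I} := HB.pack (fun w j => Y j w)
  (isMeasurableFun.Build _ _ _ _ _ mY').
apply: (@rect_measure_unique R _ (cfgspace I) I (fun j c => c j)
  (distribution P fX) (distribution P fY)) => //.
- exact: measurable_coord.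
- exact: (le_lt_trans (probability_le1 (distribution P fX) measurableT) (ltry _)).
Qed.

(** Positive and negative parts are transported separately, each by the change of variables for
    nonnegative functions. *)
Lemma same_law_integral (I : eqType) (X Y : I -> O -> R) (F : cfgspace I -> \bar R) :
  (forall j, measurable_fun setT (X j)) -> (forall j, measurable_fun setT (Y j)) ->
  (forall A : set (cfgspace I), measurable A ->
    P ((fun w j => X j w) @^-1` A) = P ((fun w j => Y j w) @^-1` A)) ->
  measurable_fun setT F ->
  (\int[P]_w F (X ^~ w) = \int[P]_w F (Y ^~ w))%E.
Proof.
move=> mX mY XY mF.
have mX' := measurable_family mX; have mY' := measurable_family mY.
pose fX : {mfun O >-> cfgspace I} := HB.pack (fun w j => X j w)
  (isMeasurableFun.Build _ _ _ _ _ mX').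
pose fY : {mfun O >-> cfgspace I} := HB.pack (fun w j => Y j w)
  (isMeasurableFun.Build _ _ _ _ _ mY').
have E (G : cfgspace I -> \bar R) : measurable_fun setT G -> (forall c, 0 <= G c)%E ->
    (\int[P]_w G (X ^~ w) = \int[P]_w G (Y ^~ w))%E.
  move=> mG G0.
  have -> : (\int[P]_w G (X ^~ w) = \int[distribution P fX]_c G c)%E.
    by rewrite ge0_integral_distribution.
  have -> : (\int[P]_w G (Y ^~ w) = \int[distribution P fY]_c G c)%E.
    by rewrite ge0_integral_distribution.
  by apply: eq_measure_integral => A mA _; exact: XY.
rewrite integralE [RHS]integralE; congr (_ - _)%E.
  rewrite (funepos_comp F (fun w j => X j w)) (funepos_comp F (fun w j => Y j w)).
  by apply: E => //; exact: measurable_funepos.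
rewrite (funeneg_comp F (fun w j => X j w)) (funeneg_comp F (fun w j => Y j w)).
  by apply: E => //; exact: measurable_funeneg.
Qed.

Lemma mutually_independent_inj (I J : eqType) (X : I -> O -> R) (h : J -> I) :
  injective h -> mutually_independent P X -> mutually_independent P (X \o h).
Proof.
move=> hI iX s B us mB.
(* The sets are carried along the inverse of [h], with the full set off its image. *)
pose B' i := if pselect (exists j, h j = i) is left e then B (projT1 (cid e)) else setT.
have hB j : B' (h j) = B j.
  rewrite /B'; case: pselect => [e|]; last by case; exists j.
  by case: cid => /= k /hI ->.
have := iX (map h s) B'; rewrite map_inj_uniq// big_map => /(_ us).
move=> H; transitivity (P (rect X (map h s) B')).
  congr (P _); rewrite rect_map; apply: eq_rect_fam => j _ /=; exact/esym.
rewrite /rect H; first by apply: eq_bigr => j _; rewrite /= hB.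
by move=> i; rewrite /B'; case: pselect.
Qed.

(* Disjoint subfamilies of a mutually independent family, presented as
   injective reindexings, generate independent sigma-algebras. *)
Lemma independent_sigma (I J J' : eqType) (X : I -> O -> R)
    (h : J -> I) (h' : J' -> I) :
  (forall j, measurable_fun setT (X j)) -> mutually_independent P X ->
  injective h -> injective h' -> (forall j j', h j != h' j') ->
  forall A A', <<s coord_events (X \o h) >> A -> <<s coord_events (X \o h') >> A' ->
  P (A `&` A') = (P A * P A')%E.
Proof.
move=> mX iX hI h'I hh' A A' sA sA'.
have base s s' B B' : uniq s -> uniq s' -> (forall j, measurable (B j)) ->
    (forall j, measurable (B' j)) ->
    P (rect (X \o h) s B `&` rect (X \o h') s' B') =
    (P (rect (X \o h) s B) * P (rect (X \o h') s' B'))%E.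
  move=> us us' mB mB'.
  (* Disjointness of the images makes this joint reindexing by the sum type injective, so mutual
     independence factors a joint rectangle at once. *)
  pose hs (x : J + J') := match x with inl j => h j | inr j => h' j end.
  pose Bs (x : J + J') := match x with inl j => B j | inr j => B' j end.
  have hsI : injective hs.
    move=> [j|j] [k|k] /=.
    - by move/hI ->.
    - by move=> e; have := hh' j k; rewrite e eqxx.
    - by move=> e; have := hh' k j; rewrite e eqxx.
    - by move/h'I ->.
  have mBs x : measurable (Bs x) by case: x.
  have iXs := mutually_independent_inj hsI iX.
  have := iXs (map inl s ++ map inr s') Bs.
  rewrite -/(rect _ _ _) rect_cat !rect_map big_cat !big_map => -> //; last first.
    rewrite cat_uniq !map_inj_uniq ?us ?us'/=; last 2 first.
    + by move=> ? ? [].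
    + by move=> ? ? [].
    by rewrite andbT; apply/hasPn => x /mapP[j _ ->]; apply/mapP => -[].
  by congr (_ * _)%E; [rewrite -(mutually_independent_inj hI iX)|
    rewrite -(mutually_independent_inj h'I iX)].
have mh j : measurable_fun setT ((X \o h) j) by exact: mX.
have mh' j : measurable_fun setT ((X \o h') j) by exact: mX.
have mA' := sigma_measurable mh' sA'.
(* For a fixed event C, both D |-> P(D and C) and D |-> P(C) P(D) are finite measures, so agreement
   on rectangles extends to the sigma-algebra. It is applied once for each of the two families. *)
have key (J1 : eqType) (h1 : J1 -> I) (C : set O) (mC : measurable C) :
    (forall s B, uniq s -> (forall j, measurable (B j)) ->
      P (rect (X \o h1) s B `&` C) = (P (rect (X \o h1) s B) * P C)%E) ->
    forall D, <<s coord_events (X \o h1) >> D -> P (D `&` C) = (P D * P C)%E.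
  move=> H D sD.
  have PC0 : 0 <= fine (P C) by exact: fine_ge0.
  rewrite -[LHS]/(mrestr P mC D) muleC -(fineK (fin_num_measure P C mC)).
  rewrite -[RHS]/(mscale (NngNum PC0) P D).
  apply: (rect_measure_unique (X := X \o h1)) sD => //=.
  - by rewrite /mrestr setTI (le_lt_trans (probability_le1 _ _))// ltry.
  - move=> s B us mB; rewrite /mrestr /mscale /= fineK ?fin_num_measure//.
    by rewrite H// muleC.
apply: (key _ h) => // s B us mB; rewrite setIC [RHS]muleC.
apply: (key _ h') => //; last first.
  by move=> s' B' us' mB'; rewrite setIC base// muleC.
by apply: (sigma_measurable mh); exact: rect_sigma.
Qed.

End laws.

(** * Second moments *)

Section L2.
Context {R : realType} {dO : measure_display} {O : measurableType dO}.
Variable P : probability O R.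
Implicit Types f g : O -> R.

(** Real-valued: an infinite integral is sent to 0, so the algebra of expectations carries
    integrability side conditions. *)
Definition Ex f : R := \int[P]_w f w.
Definition Int f : Prop := P.-integrable setT (EFin \o f).
Definition L2 f : Prop := measurable_fun setT f /\ Int (fun w => f w ^+ 2).

Lemma Int_meas f : Int f -> measurable_fun setT f.
Proof. by move=> /measurable_int /measurable_EFinP. Qed.

Lemma Int_le f g : measurable_fun setT f -> Int g -> (forall w, `|f w| <= g w) -> Int f.
Proof.
move=> mf ig fg; apply: le_integrable ig => //; first exact/measurable_EFinP.
by move=> w _ /=; rewrite lee_fin (le_trans (fg w))// ler_norm.
Qed.

Lemma Int_bounded f C : measurable_fun setT f -> (forall w, `|f w| <= C) -> Int f.
Proof.
move=> mf fC; apply: (@Int_le _ (fun=> C)) => //.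
exact: finite_measure_integrable_cst.
Qed.

Lemma Int_cst c : Int (fun=> c).
Proof. exact: finite_measure_integrable_cst. Qed.

Lemma IntD f g : Int f -> Int g -> Int (fun w => f w + g w).
Proof. exact: integrableD. Qed.

Lemma IntB f g : Int f -> Int g -> Int (fun w => f w - g w).
Proof. exact: integrableB. Qed.

Lemma IntZ a f : Int f -> Int (fun w => a * f w).
Proof. exact: integrableZl. Qed.

Lemma Int_norm f : Int f -> Int (fun w => `|f w|).
Proof. exact: integrable_abse. Qed.

Lemma Int_sum (I : eqType) (s : seq I) (F : I -> O -> R) :
  (forall i, i \in s -> Int (F i)) -> Int (fun w => \sum_(i <- s) F i w).
Proof.
elim: s => [|i s IH] h.
  rewrite (_ : (fun _ => _) = (fun=> 0)); first exact: Int_cst.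
  by apply/funext => w; rewrite big_nil.
rewrite (_ : (fun _ => _) = (fun w => F i w + \sum_(j <- s) F j w)); last first.
  by apply/funext => w; rewrite big_cons.
apply: IntD; first by apply: h; rewrite mem_head.
by apply: IH => j js; apply: h; rewrite in_cons js orbT.
Qed.

Lemma ExD f g : Int f -> Int g -> Ex (fun w => f w + g w) = Ex f + Ex g.
Proof. exact: RintegralD. Qed.

Lemma ExB f g : Int f -> Int g -> Ex (fun w => f w - g w) = Ex f - Ex g.
Proof. exact: RintegralB. Qed.

Lemma ExZ a f : Int f -> Ex (fun w => a * f w) = a * Ex f.
Proof. exact: RintegralZl. Qed.

Lemma Ex_cst a : Ex (fun=> a) = a.
Proof.
rewrite /Ex Rintegral_cst//.
by rewrite -[RHS]mulr1; congr (_ * _); exact: (congr1 fine (probability_setT P)).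
Qed.

Lemma Ex_sum (I : eqType) (s : seq I) (F : I -> O -> R) :
  (forall i, i \in s -> Int (F i)) ->
  Ex (fun w => \sum_(i <- s) F i w) = \sum_(i <- s) Ex (F i).
Proof.
elim: s => [|i s IH] h.
  by rewrite big_nil -[RHS](Ex_cst 0); congr (Ex _); apply/funext => w; rewrite big_nil.
rewrite big_cons -IH; last by move=> j js; apply: h; rewrite in_cons js orbT.
rewrite -ExD; first by congr (Ex _); apply/funext => w; rewrite big_cons.
  by apply: h; rewrite mem_head.
by apply: Int_sum => j js; apply: h; rewrite in_cons js orbT.
Qed.

Lemma Ex_ge0 f : (forall w, 0 <= f w) -> 0 <= Ex f.
Proof. by move=> f0; apply: Rintegral_ge0 => w _. Qed.

Lemma Ex_le f g : Int f -> Int g -> (forall w, f w <= g w) -> Ex f <= Ex g.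
Proof. by move=> If Ig fg; apply: le_Rintegral. Qed.

Lemma Ex_norm f : Int f -> `|Ex f| <= Ex (fun w => `|f w|).
Proof. by move=> If; apply: le_normr_Rintegral. Qed.

Lemma Ex_EFin f : Int f -> (\int[P]_w (f w)%:E = (Ex f)%:E)%E.
Proof. by move=> If; rewrite fineK//; apply: integrable_fin_num. Qed.

Lemma L2_sq f : L2 f -> Int (fun w => f w ^+ 2). Proof. by case. Qed.

Lemma L2_mul f g : L2 f -> L2 g -> Int (fun w => f w * g w).
Proof.
move=> [mf f2] [mg g2]; apply: (Int_le (measurable_funM mf mg) (IntD f2 g2)) => w.
rewrite normrM -(real_normK (num_real (f w))) -(real_normK (num_real (g w))).
by have := normr_ge0 (f w); have := normr_ge0 (g w); nra.
Qed.

Lemma L2_bounded f C : measurable_fun setT f -> (forall w, `|f w| <= C) -> L2 f.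
Proof.
move=> mf fC; split=> //; apply: (@Int_bounded _ (C ^+ 2)).
  exact: measurable_funX.
by move=> w; rewrite normrX lerXn2r// nnegrE (le_trans _ (fC w)).
Qed.

Lemma L2_cst c : L2 (fun=> c).
Proof. exact: (@L2_bounded _ `|c|). Qed.

Lemma L2_int f : L2 f -> Int f.
Proof.
move=> Lf; rewrite (_ : f = (fun w => f w * 1)); first exact: L2_mul Lf (L2_cst 1).
by apply/funext => w; rewrite mulr1.
Qed.

Lemma L2Z a f : L2 f -> L2 (fun w => a * f w).
Proof.
move=> [mf f2]; split; first exact: measurable_funM.
rewrite (_ : (fun _ => _) = (fun w => a ^+ 2 * f w ^+ 2)); first exact: IntZ.
by apply/funext => w; rewrite exprMn.
Qed.

Lemma L2D f g : L2 f -> L2 g -> L2 (fun w => f w + g w).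
Proof.
move=> Lf Lg; split; first exact: measurable_funD Lf.1 Lg.1.
rewrite (_ : (fun _ => _) = (fun w => (f w ^+ 2 + g w ^+ 2) + 2 * (f w * g w))).
  apply: IntD; first exact: IntD Lf.2 Lg.2.
  by apply: IntZ; exact: L2_mul.
by apply/funext => w; ring.
Qed.

Lemma L2B f g : L2 f -> L2 g -> L2 (fun w => f w - g w).
Proof.
move=> Lf Lg; rewrite (_ : (fun _ => _) = (fun w => f w + (-1) * g w)).
  by apply: L2D => //; exact: L2Z.
by apply/funext => w; rewrite mulN1r.
Qed.

Lemma L2_sum (I : eqType) (s : seq I) (F : I -> O -> R) :
  (forall i, i \in s -> L2 (F i)) -> L2 (fun w => \sum_(i <- s) F i w).
Proof.
elim: s => [|i s IH] h.
  rewrite (_ : (fun _ => _) = (fun=> 0)); first exact: L2_cst.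
  by apply/funext => w; rewrite big_nil.
rewrite (_ : (fun _ => _) = (fun w => F i w + \sum_(j <- s) F j w)); last first.
  by apply/funext => w; rewrite big_cons.
apply: L2D; first by apply: h; rewrite mem_head.
by apply: IH => j js; apply: h; rewrite in_cons js orbT.
Qed.

Lemma Ex_sqB f g : L2 f -> L2 g ->
  Ex (fun w => (f w - g w) ^+ 2) =
  Ex (fun w => f w * f w) + Ex (fun w => g w * g w) - 2 * Ex (fun w => f w * g w).
Proof.
move=> Lf Lg; rewrite -ExZ; last exact: L2_mul.
rewrite -ExD; [|exact: L2_mul|exact: L2_mul].
rewrite -ExB; last by apply: IntZ; exact: L2_mul.
  by congr (Ex _); apply/funext => w; ring.
by apply: IntD; exact: L2_mul.
Qed.

(** Cauchy-Schwarz against the constant 1, read off from E(|f| - m)^2 >= 0 with m = E|f|. *)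
Lemma Ex_norm_le_sqrt f : L2 f -> Ex (fun w => `|f w|) <= Num.sqrt (Ex (fun w => f w ^+ 2)).
Proof.
move=> Lf; have If := Int_norm (L2_int Lf).
have := Ex_ge0 (fun w => normr_ge0 (f w)).
set m := Ex _ => m0; rewrite -(ger0_norm m0) -sqrtr_sqr.
rewrite ler_sqrt; last by apply: Ex_ge0 => w; exact: sqr_ge0.
have : 0 <= Ex (fun w => (f w ^+ 2 - 2 * m * `|f w|) + m ^+ 2).
  apply: Ex_ge0 => w; rewrite -(real_normK (num_real (f w))).
  rewrite (_ : _ + _ = (`|f w| - m) ^+ 2); first exact: sqr_ge0.
  by ring.
rewrite ExD ?ExB ?ExZ ?Ex_cst -/m//; first by move: (Ex _) => a; nra.
all: by first [exact: Int_cst | exact: L2_sq | exact: IntZ |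
  apply: IntB; [exact: L2_sq | exact: IntZ]].
Qed.

Lemma Ex_cvg_dom (f_ : nat -> O -> R) f g :
  (forall n, measurable_fun setT (f_ n)) -> measurable_fun setT f -> Int g ->
  (forall n w, `|f_ n w| <= g w) -> {ae P, forall w, f_ ^~ w @ \oo --> f w} ->
  Ex (f_ n) @[n --> \oo] --> Ex f.
Proof.
move=> mf_ mf Ig fC ff.
have [] := @dominated_convergence _ O R P setT measurableT
  (fun n w => (f_ n w)%:E) (fun w => (f w)%:E) (fun w => (g w)%:E).
- by move=> n; exact/measurable_EFinP.
- exact/measurable_EFinP.
- by apply: filterS ff => w h _; apply: cvg_comp h _; exact: cvg_id.
- exact: Ig.
- by apply: aeW => w n _; rewrite lee_fin.
- move=> If _ cf; apply: fine_cvg.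
  by rewrite -/(Ex f) -Ex_EFin//; exact: cf.
Qed.

Lemma Ex_cvg (f_ : nat -> O -> R) f C :
  (forall n, measurable_fun setT (f_ n)) -> measurable_fun setT f ->
  (forall n w, `|f_ n w| <= C) -> {ae P, forall w, f_ ^~ w @ \oo --> f w} ->
  Ex (f_ n) @[n --> \oo] --> Ex f.
Proof.
by move=> mf_ mf fC; apply: (@Ex_cvg_dom _ _ (fun=> C)) => //; exact: Int_cst.
Qed.

Lemma Ex_ae f g : measurable_fun setT f -> measurable_fun setT g ->
  {ae P, forall w, f w = g w} -> Ex f = Ex g.
Proof.
move=> mf mg fg; rewrite /Ex /Rintegral; congr fine.
apply: ae_eq_integral => //; [exact/measurable_EFinP|exact/measurable_EFinP|].
by apply: filterS fg => w -> _.
Qed.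

(* Monotone convergence: a series bounded in L1 converges almost everywhere. *)
Lemma ae_summable (f : nat -> O -> R) (K : R) : (forall n, Int (f n)) ->
  (forall n, \sum_(k < n) Ex (fun w => `|f k w|) <= K) ->
  {ae P, forall w, cvgn (series (fun n => `|f n w|))}.
Proof.
move=> If hK.
pose G w := (\sum_(n <oo) (`|f n w|)%:E)%E.
have mf n : measurable_fun setT (fun w => (`|f n w|)%:E).
  by apply/measurable_EFinP; apply: measurableT_comp => //; exact: Int_meas.
have G0 w : (0 <= G w)%E by apply: nneseries_ge0 => n _ _; rewrite lee_fin.
have IG : P.-integrable setT G.
  apply/integrableP; split.
    by apply: ge0_emeasurable_sum => // n w _ _; rewrite lee_fin.
  under eq_integral do rewrite gee0_abs//.
  rewrite integral_nneseries//.
  apply: (le_lt_trans _ (ltry K)).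
  apply: lime_le.
    by apply: is_cvg_nneseries => n _ _; apply: integral_ge0 => w _; rewrite lee_fin.
  near=> n; rewrite big_mkord.
  under eq_bigr => k _ do rewrite (Ex_EFin (Int_norm (If k))).
  by rewrite sumEFin lee_fin.
have := integrable_ae measurableT IG.
apply: filterS => w /(_ Logic.I) fG.
apply: nondecreasing_is_cvgn.
  by apply/nondecreasing_seqP => n; rewrite /series /= big_nat_recr//= lerDl.
exists (fine (G w)) => _ [n _ <-].
rewrite -lee_fin fineK// /series /= -sumEFin.
by apply: nneseries_lim_ge => k _ _; rewrite lee_fin.
Unshelve. all: by end_near. Qed.

End L2.

(** * The energy identity *)

(** The variance of v under the weights p, written as half the mean squared difference of two
    independent samples. *)
Lemma convex_sq_var (R : realFieldType) (I : eqType) (s : seq I) (p v : I -> R) :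
  \sum_(x <- s) p x = 1 ->
  (\sum_(x <- s) p x * v x) ^+ 2 = \sum_(x <- s) p x * (v x * v x) -
    2^-1 * \sum_(x <- s) \sum_(y <- s) p x * p y * (v x - v y) ^+ 2.
Proof.
move=> p1.
set A := \sum_(x <- s) p x * (v x * v x); set B := \sum_(x <- s) p x * v x.
have -> : \sum_(x <- s) \sum_(y <- s) p x * p y * (v x - v y) ^+ 2 =
    2 * A - 2 * B ^+ 2.
  transitivity (\sum_(x <- s) (p x * (v x * v x) + p x * A - 2 * (p x * v x) * B)).
    apply: eq_bigr => x _.
    transitivity (p x * (v x * v x) * (\sum_(y <- s) p y) + p x * A -
                  2 * (p x * v x) * B); last by rewrite p1 mulr1.
    rewrite /A /B !mulr_sumr -big_split -sumrB; apply: eq_bigr => y _ /=.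
    by ring.
  rewrite sumrB big_split /= -!mulr_suml p1 -mulr_sumr -/A -/B; ring.
by field.
Qed.

Lemma series_to0 (R : realType) (u : nat -> R) (C : R) :
  (forall n, 0 <= u n) -> (forall n, \sum_(k < n) u k <= C) -> u n @[n --> \oo] --> 0.
Proof.
move=> u0 uC; apply: cvg_series_cvg_0; apply: nondecreasing_is_cvgn.
  by apply/nondecreasing_seqP => n; rewrite /series /= big_nat_recr//= lerDl.
by exists C => _ [n _ <-]; rewrite /series /= big_mkord.
Qed.

Section energy.
Context {R : realType} {d : nat} {dO : measure_display} {O : measurableType dO}.
Variable P : probability O R.
Notation field := (site d -> O -> R).
Notation Ex := (Ex P). Notation L2 := (L2 P). Notation Int := (Int P).

(** Only mixed second moments are asked to be shift invariant: this survives averaging and holds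
    both for the noise and for bounded functions of the shifted [zeta]. *)
Definition stat2 (Z : field) : Prop := (forall x, L2 (Z x)) /\
  forall a x y, Ex (fun w => Z (x + a) w * Z (y + a) w) = Ex (fun w => Z x w * Z y w).

Variables (s : seq (site d)) (p : site d -> R).
Hypothesis sp : ker_on s p.

Definition avgF k (Z : field) : field := fun x w => iter k (avg s p) (Z ^~ w) x.

Lemma avgF_S k Z x w : avgF k.+1 Z x w = \sum_(z <- s) p z * avgF k Z (x + z) w.
Proof. by []. Qed.

Lemma avgF_L2 k Z x : (forall x, L2 (Z x)) -> L2 (avgF k Z x).
Proof.
move=> LZ; elim: k x => // k IH x; apply: L2_sum => z _.
exact: L2Z (IH (x + z)).
Qed.

Lemma avgF_mul_expand k Z x y : (forall x, L2 (Z x)) ->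
  Ex (fun w => avgF k.+1 Z x w * avgF k.+1 Z y w) =
  \sum_(z <- s) \sum_(z' <- s)
     p z * p z' * Ex (fun w => avgF k Z (x + z) w * avgF k Z (y + z') w).
Proof.
move=> LZ; have LA x' := avgF_L2 k x' LZ.
have Lm x' y' : Int (fun w => avgF k Z x' w * avgF k Z y' w) by exact: L2_mul.
transitivity (Ex (fun w => \sum_(z <- s) \sum_(z' <- s)
    p z * p z' * (avgF k Z (x + z) w * avgF k Z (y + z') w))).
  congr (Ex _); apply/funext => w; rewrite !avgF_S mulr_suml.
  by apply: eq_bigr => z _; rewrite mulr_sumr; apply: eq_bigr => z' _; ring.
rewrite Ex_sum; last by move=> z _; apply: Int_sum => z' _; exact: IntZ.
apply: eq_bigr => z _; rewrite Ex_sum; last by move=> z' _; exact: IntZ.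
by apply: eq_bigr => z' _; rewrite ExZ.
Qed.

Lemma avgF_stat2 k Z : stat2 Z -> stat2 (avgF k Z).
Proof.
move=> [LZ SZ]; split=> [x|]; first exact: avgF_L2.
elim: k => // k IH a x y; rewrite !avgF_mul_expand//.
by apply: eq_bigr => z _; apply: eq_bigr => z' _; rewrite !(addrAC _ a) IH.
Qed.

Lemma stat2_diff Z a x y : stat2 Z ->
  Ex (fun w => (Z (x + a) w - Z (y + a) w) ^+ 2) = Ex (fun w => (Z x w - Z y w) ^+ 2).
Proof. by move=> [LZ SZ]; rewrite !Ex_sqB// !SZ. Qed.

Lemma stat2_sq Z x y : stat2 Z ->
  Ex (fun w => Z x w ^+ 2) = Ex (fun w => Z y w ^+ 2).
Proof.
move=> [LZ SZ]; have := SZ (x - y) y y; rewrite addrC subrK.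
by under [in X in X -> _]eq_fun do rewrite -expr2.
Qed.

(** This is [convex_sq_var] at each sample point, integrated; the first sum collapses because E(A^k
    Z(x))^2 is the same at every site. *)
Lemma energy k Z : stat2 Z ->
  Ex (fun w => avgF k.+1 Z 0 w ^+ 2) = Ex (fun w => avgF k Z 0 w ^+ 2) -
  2^-1 * \sum_(x <- s) \sum_(y <- s) p x * p y *
    Ex (fun w => (avgF k Z x w - avgF k Z y w) ^+ 2).
Proof.
move=> SZ; have [LA SA] := avgF_stat2 k SZ; have [_ _ _ p1] := sp.
have LB x y : Int (fun w => (avgF k Z x w - avgF k Z y w) ^+ 2).
  by apply: L2_sq; exact: L2B.
have I2 x : Int (fun w => \sum_(y <- s) p x * p y * (avgF k Z x w - avgF k Z y w) ^+ 2).
  by apply: Int_sum => y _; exact: IntZ.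
have I3 : Int (fun w => \sum_(x <- s) p x * (avgF k Z x w * avgF k Z x w)).
  by apply: Int_sum => y _; apply: IntZ; exact: L2_mul.
transitivity (Ex (fun w => (\sum_(x <- s) p x * (avgF k Z x w * avgF k Z x w)) -
   2^-1 * (\sum_(x <- s) \sum_(y <- s) p x * p y * (avgF k Z x w - avgF k Z y w) ^+ 2))).
  congr (Ex _); apply/funext => w; rewrite avgF_S -convex_sq_var//.
  by under eq_bigr do rewrite add0r.
rewrite ExB//; last by apply: IntZ; exact: Int_sum.
congr (_ - _).
  rewrite Ex_sum; last by move=> x _; apply: IntZ; exact: L2_mul.
  under eq_bigr => x _.
    rewrite ExZ; last exact: L2_mul.
    rewrite (_ : Ex _ = Ex (fun w => avgF k Z 0 w ^+ 2)); last first.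
      rewrite (stat2_sq 0 x (avgF_stat2 k SZ)).
      by congr (Ex _); apply/funext => w; rewrite expr2.
  over.
  by rewrite -mulr_suml p1 mul1r.
rewrite ExZ; last exact: Int_sum.
congr (_ * _); rewrite Ex_sum//; apply: eq_bigr => x _; rewrite Ex_sum.
  by apply: eq_bigr => y _; rewrite ExZ.
by move=> y _; exact: IntZ.
Qed.

Lemma energy_sum n Z : stat2 Z ->
  \sum_(k < n) \sum_(x <- s) \sum_(y <- s) p x * p y *
    Ex (fun w => (avgF k Z x w - avgF k Z y w) ^+ 2) =
  2 * (Ex (fun w => Z 0 w ^+ 2) - Ex (fun w => avgF n Z 0 w ^+ 2)).
Proof.
move=> SZ; elim: n => [|n IH]; first by rewrite big_ord0 subrr mulr0.
by rewrite big_ord_recr /= IH energy//; field.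
Qed.

Lemma avgF_contract k Z : stat2 Z ->
  Ex (fun w => avgF k Z 0 w ^+ 2) <= Ex (fun w => Z 0 w ^+ 2).
Proof.
move=> SZ; have [_ _ p0 _] := sp.
have : 0 <= \sum_(k < k) \sum_(x <- s) \sum_(y <- s) p x * p y *
    Ex (fun w => (avgF k Z x w - avgF k Z y w) ^+ 2).
  apply: sumr_ge0 => i _; apply: sumr_ge0 => x _; apply: sumr_ge0 => y _.
  by rewrite !mulr_ge0//; apply: Ex_ge0 => w; exact: sqr_ge0.
by rewrite energy_sum//; move: (Ex _) (Ex _) => a b; lra.
Qed.

Hypothesis ap : strongly_aperiodic p.

Lemma increments_summable Z x y : stat2 Z ->
  exists C : R, forall n,
    \sum_(k < n) Ex (fun w => (avgF k Z x w - avgF k Z y w) ^+ 2) <= C.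
Proof.
move=> SZ; have [us sE p0 _] := sp.
pose D k x := Ex (fun w => (avgF k Z x w - avgF k Z 0 w) ^+ 2).
have DE k x' y' : Ex (fun w => (avgF k Z x' w - avgF k Z y' w) ^+ 2) = D k (x' - y').
  by rewrite -(stat2_diff (- y') _ _ (avgF_stat2 k SZ)) subrr.
have D0 k x' : 0 <= D k x' by apply: Ex_ge0 => w; exact: sqr_ge0.
suff : exists C : R, forall n, \sum_(k < n) D k (x - y) <= C.
  by move=> [C hC]; exists C => n; under eq_bigr do rewrite DE.
move: (x - y); apply: (aperiodic_ind (G := [set z | exists C : R, forall n,
  \sum_(k < n) D k z <= C]) sp ap).
  split=> /=.
    exists 0 => n; rewrite big1// => k _; rewrite /D.
    by under eq_fun do rewrite subrr expr0n; rewrite Ex_cst.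
  move=> x' y' [C hC] [C' hC']; exists (2 * C + 2 * C') => n.
  apply: (@le_trans _ _ (2 * (\sum_(k < n) D k x') + 2 * (\sum_(k < n) D k y'))).
    rewrite !mulr_sumr -big_split; apply: ler_sum => k _ /=.
    have LA z := avgF_L2 k z SZ.1.
    have LB z z' : Int (fun w => (avgF k Z z w - avgF k Z z' w) ^+ 2).
      by apply: L2_sq; exact: L2B.
    rewrite -DE /D -!ExZ// -ExD//; [|exact: IntZ|exact: IntZ].
    apply: Ex_le => //; first by apply: IntD; exact: IntZ.
    (* With c the value at 0: (a - b)^2 + (a + b - 2c)^2 = 2(a - c)^2 + 2(b - c)^2. *)
    move=> w; have := sqr_ge0 (avgF k Z x' w + avgF k Z y' w - 2 * avgF k Z 0 w).
    by move: (avgF _ _ _ _) (avgF _ _ _ _) (avgF _ _ _ _) => a b c; nra.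
  by apply: lerD; rewrite ler_pM2l ?hC ?hC'.
move=> a b as_ bs; have pa : 0 < p a by rewrite lt0r -sE as_ p0.
have pb : 0 < p b by rewrite lt0r -sE bs p0.
(* The total energy is at most 2 E Z(0)^2, and the pair (a, b) enters it with weight p(a) p(b); all
   other terms are nonnegative and dropped. *)
exists ((p a * p b)^-1 * (2 * Ex (fun w => Z 0 w ^+ 2))) => n.
rewrite ler_pdivlMl ?mulr_gt0// mulr_sumr.
apply: (@le_trans _ _ (2 * (Ex (fun w => Z 0 w ^+ 2) - Ex (fun w => avgF n Z 0 w ^+ 2)))).
  rewrite -energy_sum//; apply: ler_sum => k _; rewrite -DE.
  have H0 z z' : 0 <= p z * p z' * Ex (fun w => (avgF k Z z w - avgF k Z z' w) ^+ 2).
    by rewrite !mulr_ge0//; apply: Ex_ge0 => w; exact: sqr_ge0.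
  rewrite (bigD1_seq a)//= (bigD1_seq b)//= -addrA lerDl addr_ge0//.
    exact: sumr_ge0.
  by apply: sumr_ge0 => z _; exact: sumr_ge0.
have : 0 <= Ex (fun w => avgF n Z 0 w ^+ 2) by apply: Ex_ge0 => w; exact: sqr_ge0.
by move: (Ex _) (Ex _) => u v; lra.
Qed.

Lemma increments_to0 Z x y : stat2 Z ->
  Ex (fun w => (avgF k Z x w - avgF k Z y w) ^+ 2) @[k --> \oo] --> 0.
Proof.
move=> /(increments_summable x y)[C hC]; apply: series_to0 hC => n.
by apply: Ex_ge0 => w; exact: sqr_ge0.
Qed.

End energy.

(** * The noise series *)

Section iid.
Context {R : realType} {dO : measure_display} {O : measurableType dO}.
Variable P : probability O R.
Notation Ex := (Ex P). Notation L2 := (L2 P). Notation Int := (Int P).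

Lemma rect1 (I : eqType) (X : I -> O -> R) j B : rect X [:: j] B = X j @^-1` B j.
Proof.
apply/seteqP; split=> w; first by move/(_ j); apply=> /=; rewrite mem_head.
by move=> hw i /=; rewrite inE => /eqP ->.
Qed.

(** Independence identifies the law of the pair with the product law; by Fubini the inner integral
    is a multiple of E X_j = 0. *)
Lemma independent_mean0_orth (I : eqType) (X : I -> O -> R) i j :
  mutually_independent P X -> i != j -> L2 (X i) -> L2 (X j) ->
  Ex (X j) = 0 -> Ex (fun w => X i w * X j w) = 0.
Proof.
move=> iX ij Li Lj Ej0.
have mi := Li.1; have mj := Lj.1.
pose fi : {mfun O >-> R} := HB.pack (X i) (isMeasurableFun.Build _ _ _ _ _ mi).
pose fj : {mfun O >-> R} := HB.pack (X j) (isMeasurableFun.Build _ _ _ _ _ mj).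
have mp : measurable_fun setT (fun w => (X i w, X j w)) by exact: measurable_fun_pair.
pose fp : {mfun O >-> (R * R)%type} := HB.pack (fun w => (X i w, X j w))
  (isMeasurableFun.Build _ _ _ _ _ mp).
have E A : measurable A -> ((distribution P fi) \x (distribution P fj))%E A =
    distribution P fp A.
  apply: product_measure_unique => B C mB mC.
  have := iX [:: i; j] (fun k => if k == i then B else C).
  rewrite /= inE ij => /(_ isT); rewrite -/(rect _ _ _) (rect_cat X [:: i] [:: j]).
  rewrite !rect1 !big_cons big_nil mule1 eqxx eq_sym (negbTE ij); apply=> k.
  by case: ifP.
pose g (z : R * R) : \bar R := (z.1 * z.2)%:E.
have mg : measurable_fun setT g.
  by apply/measurable_EFinP; apply: measurable_funM; [exact: measurable_fst|exact: measurable_snd].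
have Ig : P.-integrable setT (g \o fp) by exact: (L2_mul Li Lj).
have Igp : (distribution P fp).-integrable setT g.
  by apply: (integrable_pushforward mp) => //.
have Igx : ((distribution P fi) \x (distribution P fj))%E.-integrable setT g.
  apply/integrableP; split=> //; rewrite (eq_measure_integral (distribution P fp)).
    by move/integrableP : Igp => [].
  by move=> A mA _; exact: E.
rewrite /Ex /Rintegral.
have -> : (\int[P]_w (X i w * X j w)%:E = \int[distribution P fp]_z g z)%E.
  by rewrite integral_distribution.
rewrite (eq_measure_integral ((distribution P fi) \x (distribution P fj))%E); last first.
  by move=> A mA _; exact/esym/E.
rewrite -integral12_prod_meas1//.
rewrite (_ : (\int[_]_x _)%E = 0%E)//.
rewrite -[RHS](integral0 (distribution P fi) setT); apply: eq_integral => x _.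
rewrite /= /fubini_F /g /=; under eq_integral do rewrite EFinM.
have Ij : P.-integrable setT (EFin \o fj) by exact: (L2_int Lj).
have Ijd : (distribution P fj).-integrable setT EFin.
  by apply: (integrable_pushforward mj) => //; exact/measurable_EFinP.
rewrite integralZl// (_ : (\int[_]_y y%:E)%E = 0%E) ?mule0//.
rewrite integral_distribution//.
by rewrite (Ex_EFin Ij) Ej0.
Qed.

Definition id_distributed (I : Type) (X : I -> O -> R) :=
  forall i j B, measurable B -> P (X i @^-1` B) = P (X j @^-1` B).

Lemma iid_reindex_law (I J : eqType) (X : I -> O -> R) (h h' : J -> I) s B :
  mutually_independent P X -> id_distributed X -> injective h -> injective h' ->
  uniq s -> (forall j, measurable (B j)) ->
  P (rect (X \o h) s B) = P (rect (X \o h') s B).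
Proof.
move=> iX dX hI h'I us mB.
rewrite /rect (mutually_independent_inj hI iX)// (mutually_independent_inj h'I iX)//.
by apply: eq_bigr => j _; exact: dX.
Qed.

(** The law of an i.i.d. family does not change under injective relabelling. Equality of increment
    variances across time, stationarity of the noise and the time change from S_t to [Delta0] are
    all instances. *)
Lemma iid_reindex_integral (I J : eqType) (X : I -> O -> R) (h h' : J -> I)
    (F : g_sigma_algebraType (coord_events (fun j (c : J -> R) => c j)) -> R) :
  (forall i, measurable_fun setT (X i)) ->
  mutually_independent P X -> id_distributed X -> injective h -> injective h' ->
  measurable_fun setT F ->
  Ex (fun w => F (fun j => X (h j) w)) = Ex (fun w => F (fun j => X (h' j) w)).
Proof.
move=> mX iX dX hI h'I mF; rewrite /Ex /Rintegral; congr fine.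
apply: (same_law_integral (X := X \o h) (Y := X \o h') (F := EFin \o F)).
- by move=> j; exact: mX.
- by move=> j; exact: mX.
- apply: same_law; [by move=> j; exact: mX|by move=> j; exact: mX|].
  by move=> s B us mB; exact: iid_reindex_law.
- exact/measurable_EFinP.
Qed.

End iid.

Section iter_avg_measurable.
Context {R : realType} {d : nat}.

Lemma measurable_iter_avg dT (T : measurableType dT) s (p : site d -> R) k
    (c : T -> site d -> R) x :
  (forall y, measurable_fun setT (fun w => c w y)) ->
  measurable_fun setT (fun w => iter k (avg s p) (c w) x).
Proof.
move=> mc; elim: k x => [|k IH] x /=; first exact: mc.
by apply: measurable_sum => z; apply: measurable_funM.
Qed.

End iter_avg_measurable.

Section noise.
Context {R : realType} {d : nat} {dO : measure_display} {O : measurableType dO}.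
Variable P : probability O R.
Notation Ex := (Ex P). Notation L2 := (L2 P). Notation Int := (Int P).
Variables (s : seq (site d)) (p : site d -> R).
Hypotheses (sp : ker_on s p) (ap : strongly_aperiodic p).

Variable X : nat * site d -> O -> R.
Hypotheses (LX : forall j, L2 (X j)) (iX : mutually_independent P X)
  (dX : id_distributed P X) (X0 : forall j, Ex (X j) = 0).
Variables a b : site d.

(** With [X (k, z)] the noise at time -k, a = x and b = x - e_i, this is the k-th term of the series
    [Delta0]. *)
Definition noise_incr k w :=
  iter k (avg s p) (fun z => X (k, z) w) a - iter k (avg s p) (fun z => X (k, z) w) b.

Let mX j : measurable_fun setT (X j) := (LX j).1.

Lemma noise_incr_L2 k : L2 (noise_incr k).
Proof.
by apply: L2B; apply: (@avgF_L2 _ _ _ _ P s p k (fun z => X (k, z))) => z.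
Qed.

Lemma avgF_orth k (Z : site d -> O -> R) V x : L2 V -> (forall x, L2 (Z x)) ->
  (forall x, Ex (fun w => V w * Z x w) = 0) -> Ex (fun w => V w * avgF s p k Z x w) = 0.
Proof.
move=> LV LZ VZ; elim: k x => [|k IH] x; first exact: VZ.
transitivity (Ex (fun w => \sum_(z <- s) p z * (V w * avgF s p k Z (x + z) w))).
  congr (Ex _); apply/funext => w; rewrite avgF_S mulr_sumr.
  by apply: eq_bigr => z _; rewrite mulrCA.
have LA y : L2 (avgF s p k Z y) by exact: avgF_L2.
rewrite Ex_sum; last by move=> z _; apply: IntZ; exact: L2_mul.
by rewrite big1// => z _; rewrite ExZ ?IH ?mulr0//; exact: L2_mul.
Qed.

(** Different times use different noise variables; linearity in one factor and then in the other
    reduces to the orthogonality of [X (k, z')] and [X (l, z)]. *)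
Lemma noise_incr_orth k l : k != l -> Ex (fun w => noise_incr k w * noise_incr l w) = 0.
Proof.
have half V m y : L2 V -> (forall z, Ex (fun w => V w * X (m, z) w) = 0) ->
    Ex (fun w => V w * iter m (avg s p) (fun z => X (m, z) w) y) = 0.
  by move=> LV VX; apply: (@avgF_orth m (fun z => X (m, z)) V).
have Lit m y : L2 (fun w => iter m (avg s p) (fun z => X (m, z) w) y).
  exact: (@avgF_L2 _ _ _ _ P s p m (fun z => X (m, z))).
have full V m : L2 V -> (forall z, Ex (fun w => V w * X (m, z) w) = 0) ->
    Ex (fun w => V w * noise_incr m w) = 0.
  move=> LV VX; rewrite -[RHS](subr0 0) -{1}(half V m a LV VX) -(half V m b LV VX).
  rewrite -ExB; [|exact: L2_mul|exact: L2_mul].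
  by congr (Ex _); apply/funext => w; rewrite mulrBr.
move=> kl; apply: (full) => [|z]; first exact: noise_incr_L2.
rewrite (_ : (fun _ => _) = (fun w => X (l, z) w * noise_incr k w)); last first.
  by apply/funext => w; rewrite mulrC.
apply: full => // z'; apply: independent_mean0_orth => //.
by rewrite xpair_eqE eq_sym (negbTE kl).
Qed.

(** Moving the noise from time k to time 0 turns the variances into increments of A^k applied to one
    fixed stationary field, the form that [increments_summable] bounds. *)
Lemma noise_incr_var k : Ex (fun w => noise_incr k w ^+ 2) =
  Ex (fun w => (avgF s p k (fun z => X (0%N, z)) a w -
                avgF s p k (fun z => X (0%N, z)) b w) ^+ 2).
Proof.
apply: (iid_reindex_integral (h := fun z => (k, z)) (h' := fun z => (0%N, z))
  (F := fun c => (iter k (avg s p) c a - iter k (avg s p) c b) ^+ 2)) => //.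
- by move=> z z' [].
- by move=> z z' [].
- apply: measurable_funX; apply: measurable_funB;
    by apply: measurable_iter_avg => y; exact: measurable_coord.
Qed.

Lemma noise_stat2 : stat2 P (fun z => X (0%N, z)).
Proof.
split=> // c x y.
apply: (iid_reindex_integral (h := fun z => (0%N, z + c)) (h' := fun z => (0%N, z))
  (F := fun c => c x * c y)) => //.
- by move=> z z' [] /addIr.
- by move=> z z' [].
- by apply: measurable_funM; exact: measurable_coord.
Qed.

Lemma noise_var_summable : exists C : R, forall n,
  \sum_(k < n) Ex (fun w => noise_incr k w ^+ 2) <= C.
Proof.
have [C hC] := increments_summable sp ap a b noise_stat2.
by exists C => n; under eq_bigr do rewrite noise_incr_var.
Qed.

Lemma noise_block_var n m :
  Ex (fun w => (\sum_(n <= k < m) noise_incr k w) ^+ 2) =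
  \sum_(n <= k < m) Ex (fun w => noise_incr k w ^+ 2).
Proof.
have LN k := noise_incr_L2 k.
elim: m => [|m IH].
  by rewrite !big_geq// -[RHS](Ex_cst P); congr (Ex _); apply/funext => w;
    rewrite big_geq// expr0n.
have [nm|nm] := leqP n m; last first.
  by rewrite !big_geq// -[RHS](Ex_cst P); congr (Ex _); apply/funext => w;
    rewrite big_geq// expr0n.
rewrite big_nat_recr//= -IH.
have LS : L2 (fun w => \sum_(n <= k < m) noise_incr k w) by apply: L2_sum => k _.
have L1 k : Int (fun w => noise_incr k w * noise_incr m w) by exact: L2_mul.
transitivity (Ex (fun w => (\sum_(n <= k < m) noise_incr k w) ^+ 2 +
   noise_incr m w ^+ 2 + 2 * \sum_(n <= k < m) (noise_incr k w * noise_incr m w))).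
  by congr (Ex _); apply/funext => w; rewrite big_nat_recr//= -mulr_suml; ring.
rewrite !ExD//; [|exact: L2_sq|exact: L2_sq| |].
- rewrite ExZ; last by apply: Int_sum.
  rewrite Ex_sum// big_nat big1 ?mulr0 ?addr0// => k /andP[_ km].
  by rewrite noise_incr_orth// ltn_eqF.
- by apply: IntD; exact: L2_sq.
- by apply: IntZ; apply: Int_sum.
Qed.

End noise.

(** * Almost sure convergence *)

(** Measurability is asked only for indices in the list, since increments of other times need not be
    measurable for the sigma-algebra of the past or of the future. *)
Lemma measurable_sum_seq dT (T : measurableType dT) (R : realType) (I : eqType)
    (s : seq I) (f : I -> T -> R) :
  (forall i, i \in s -> measurable_fun setT (f i)) ->
  measurable_fun setT (fun w => \sum_(i <- s) f i w).
Proof.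
move=> mf; rewrite (_ : (fun _ => _) =
    (fun w => \sum_(i <- s) (if i \in s then f i else fun=> 0) w)).
  by apply: measurable_sum => i; case: ifP => // /mf.
by apply/funext => w; apply: eq_big_seq => i ->.
Qed.

Lemma measurable_ge_set dT (T : measurableType dT) (R : realType) (f : T -> R) c :
  measurable_fun setT f -> measurable [set w | c <= f w].
Proof.
move=> mf; rewrite (_ : [set w | _] = f @^-1` [set` `[c, +oo[]).
  by rewrite -[X in measurable X]setTI; apply: mf => //; exact: measurable_itv.
by apply/seteqP; split=> w /=; rewrite in_itv /= andbT.
Qed.

Lemma measurable_lt_set dT (T : measurableType dT) (R : realType) (f : T -> R) c :
  measurable_fun setT f -> measurable [set w | f w < c].
Proof.
move=> mf; rewrite (_ : [set w | _] = ~` [set w | c <= f w]).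
  by apply: measurableC; exact: measurable_ge_set.
by apply/seteqP; split=> w /=; rewrite ltNge => /negP.
Qed.

Section maximal.
Context {R : realType} {dO : measure_display} {O : measurableType dO}.
Variable P : probability O R.
Notation Ex := (Ex P). Notation L2 := (L2 P). Notation Int := (Int P).

Lemma chebyshev_sq f l : 0 < l -> L2 f ->
  (P [set w | (l <= `|f w|)%R] <= (Ex (fun w => f w ^+ 2) / l ^+ 2)%:E)%E.
Proof.
move=> l0 Lf; set A := [set w | _].
have mA : measurable A.
  by apply: measurable_ge_set; apply: measurableT_comp => //; exact: Lf.1.
have mI : measurable_fun setT (\1_A : O -> R) by exact: measurable_indic.
have II : Int (\1_A).
  apply: (@Int_bounded _ _ _ _ _ 1) => // w.
  by rewrite indicE; case: (_ \in _); rewrite ?normr1 ?normr0.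
rewrite -[X in P X]setIT -integral_indic// (Ex_EFin II) lee_fin.
rewrite ler_pdivlMr ?exprn_gt0// mulrC -ExZ//.
apply: Ex_le; [exact: IntZ|exact: L2_sq|] => w.
rewrite indicE; have [wA|_] := boolP (w \in A); last by rewrite mulr0 sqr_ge0.
move: wA; rewrite inE /A /= mulr1 => h.
by rewrite -(real_normK (num_real (f w))) lerXn2r// nnegrE; exact: ltW.
Qed.

(* Etemadi's inequality; unlike Kolmogorov's it only uses the independence of
   events. *)
Lemma etemadi (T_ : nat -> O -> R) N l (c : \bar R) :
  (forall j, measurable_fun setT (T_ j)) -> (0 <= c)%E ->
  (forall j, (j <= N)%N ->
     let A := [set w | 3 * l <= `|T_ j w| /\ forall i, (i < j)%N -> `|T_ i w| < 3 * l] in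
     let F := [set w | 2 * l <= `|T_ N w - T_ j w|] in
     P (A `&` F) = (P A * P F)%E /\ (P F <= c)%E) ->
  (P [set w | exists2 i, (i <= N)%N & (3 * l <= `|T_ i w|)%R] <=
   P [set w | (l <= `|T_ N w|)%R] + c)%E.
Proof.
move=> mT c0 H.
(* [A j] is the event that the level 3 l is first reached at j; these events are disjoint, and [M m]
   is the union of those with j < m. *)
pose A j := [set w | 3 * l <= `|T_ j w| /\ forall i, (i < j)%N -> `|T_ i w| < 3 * l].
pose M m := [set w | exists2 i, (i < m)%N & 3 * l <= `|T_ i w|].
pose E := [set w | `|T_ N w| < l].
have mn j : measurable_fun setT (fun w => `|T_ j w|) by exact: measurableT_comp.
have mE : measurable E by exact: measurable_lt_set.
have MS m : M m.+1 = M m `|` A m.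
  apply/seteqP; split=> w.
    move=> [i]; rewrite ltnS leq_eqVlt => /orP[/eqP ->|im] h; last by left; exists i.
    have [Mw|nM] := pselect (M m w); first by left.
    right; split=> // j jm; rewrite ltNge; apply/negP => h'; apply: nM; by exists j.
  by move=> [[i im h]|[h _]]; [exists i => //; rewrite ltnS ltnW|exists m].
have mM m : measurable (M m).
  elim: m => [|m IH].
    by rewrite (_ : M 0%N = set0)//; apply/seteqP; split=> w // [].
  rewrite (_ : M m.+1 = M m `|` [set w | 3 * l <= `|T_ m w|]).
    by apply: measurableU => //; exact: measurable_ge_set.
  apply/seteqP; split=> w.
    by move=> [i]; rewrite ltnS leq_eqVlt => /orP[/eqP ->|im] h; [right|left; exists i].
  by move=> [[i im h]|h]; [exists i => //; rewrite ltnS ltnW|exists m].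
have dA m : M m `&` A m = set0.
  by apply/seteqP; split=> w // [[i im h]] [_ /(_ _ im)]; rewrite ltNge h.
have mA m : measurable (A m).
  rewrite (_ : A m = [set w | 3 * l <= `|T_ m w|] `\` M m).
    by apply: measurableD => //; exact: measurable_ge_set.
  apply/seteqP; split=> w.
    move=> [h h']; split=> // -[i im]; rewrite leNgt h'//.
  move=> [h h']; split=> // i im; rewrite ltNge; apply/negP => h2.
  by apply: h'; exists i.
have mF j : measurable [set w | 2 * l <= `|T_ N w - T_ j w|].
  apply: measurable_ge_set; apply: measurableT_comp => //.
  exact: measurable_funB.
have claim m : (m <= N.+1)%N -> (P (M m `&` E) <= c * P (M m))%E.
  elim: m => [|m IH] mN.
    rewrite (_ : M 0%N = set0); last by apply/seteqP; split=> w // [].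
    by rewrite set0I measure0 mule0.
  rewrite MS setIUl measureU//; first last.
  - by rewrite setIACA dA set0I.
  - exact: measurableI.
  - exact: measurableI.
  rewrite measureU// ge0_muleDr//; apply: leeD; first exact: IH (ltnW mN).
  have [ind Fc] := H m mN.
  (* On [A m] with |T_N| < l, the remaining sum T_N - T_m has modulus at least 3 l - l = 2 l. *)
  apply: (@le_trans _ _ (P (A m `&` [set w | (2 * l <= `|T_ N w - T_ m w|)%R]))%E).
    apply: le_measure; rewrite ?inE; [exact: measurableI|exact: measurableI|].
    move=> w [Aw Ew]; split=> //=; have [h3 _] := Aw; move: Ew; rewrite /E /=.
    have := ler_normB (T_ N w) (T_ N w - T_ m w).
    rewrite (_ : T_ N w - (T_ N w - T_ m w) = T_ m w); last by ring.
    by move: h3; lra.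
  by rewrite ind muleC; apply: lee_wpmul2r.
have -> : [set w | exists2 i, (i <= N)%N & 3 * l <= `|T_ i w|] = M N.+1.
  by apply/seteqP; split=> w [i im h]; exists i.
apply: (@le_trans _ _ (P [set w | (l <= `|T_ N w|)%R] + P (M N.+1 `&` E))%E).
  have mG : measurable [set w | l <= `|T_ N w|] by exact: measurable_ge_set.
  apply: le_trans (measureU2 _ _ _) => //; last exact: measurableI.
  apply: le_measure; rewrite ?inE//.
    by apply: measurableU => //; exact: measurableI.
  move=> w Mw; have [h|h] := leP l `|T_ N w|; [by left|by right].
rewrite leeD2l//; apply: le_trans (claim _ _) _ => //.
by rewrite -[leRHS]mule1 lee_wpmul2l// probability_le1.
Qed.

End maximal.

Section noise_cvg.
Context {R : realType} {d : nat} {dO : measure_display} {O : measurableType dO}.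
Variable P : probability O R.
Notation Ex := (Ex P). Notation L2 := (L2 P). Notation Int := (Int P).
Variables (s : seq (site d)) (p : site d -> R).
Hypotheses (sp : ker_on s p) (ap : strongly_aperiodic p).

Variable X : nat * site d -> O -> R.
Hypotheses (LX : forall j, L2 (X j)) (iX : mutually_independent P X)
  (dX : id_distributed P X) (X0 : forall j, Ex (X j) = 0).
Variables a b : site d.

Let mX j : measurable_fun setT (X j) := (LX j).1.
Local Notation Y := (noise_incr s p X a b).
Local Notation S n := (fun w => \sum_(k < n) Y k w).

Let block n m w : \sum_(n <= k < n + m) Y k w = S (n + m)%N w - S n w.
Proof.
have E m' : \sum_(k < m') Y k w = \sum_(0 <= k < m') Y k w by rewrite big_mkord.
by rewrite !E (@big_cat_nat _ _ _ n 0 (n + m))// ?leq_addr// addrC addKr.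
Qed.

Let LY k : L2 (Y k). Proof. exact: noise_incr_L2. Qed.

Let measurable_incr (J : eqType) (h : J -> nat * site d) k :
  (forall z, exists j, h j = (k, z)) ->
  measurable_fun setT (Y k : g_sigma_algebraType (coord_events (X \o h)) -> R).
Proof.
move=> hk; apply: measurable_funB; apply: measurable_iter_avg => z;
  have [j hj] := hk z; rewrite -hj => _ B mB; rewrite setTI;
  by apply: sub_sigma_algebra; exists j, B.
Qed.

(** Subtypes rather than predicates: [independent_sigma] takes its subfamilies as injective
    reindexings, here [val]. *)
Let past n := {j : nat * site d | (j.1 < n)%N}.
Let future n := {j : nat * site d | (n <= j.1)%N}.

(** Chebyshev bounds P(|T_N| >= l) by v / l^2, and the same number bounds the tails P(|T_N - T_j| >=
    2 l) required by [etemadi]; the factor 2 is their sum. *)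
Lemma noise_maximal n N l (v : R) : 0 < l -> 0 <= v ->
  (forall m, \sum_(n <= k < n + m) Ex (fun w => Y k w ^+ 2) <= v) ->
  (P [set w | exists2 i, (i <= N)%N & (3 * l <= `|S (n + i)%N w - S n w|)%R] <=
   (2 * v / l ^+ 2)%:E)%E.
Proof.
move=> l0 v0 hv.
pose T_ j w := \sum_(n <= k < n + j) Y k w.
have LT u m : L2 (fun w => \sum_(u <= k < m) Y k w).
  by apply: L2_sum => k _; exact: LY.
have sub u m : (n <= u)%N -> (u <= m)%N ->
    \sum_(u <= k < m) Ex (fun w => Y k w ^+ 2) <= v.
  move=> nu um; have nm := leq_trans nu um.
  apply: le_trans (hv (m - n)%N); rewrite subnKC//.
  rewrite [leRHS](@big_cat_nat _ _ _ u n m)//= lerDr.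
  by apply: sumr_ge0 => k _; apply: Ex_ge0 => w; exact: sqr_ge0.
have -> : [set w | exists2 i, (i <= N)%N & 3 * l <= `|S (n + i)%N w - S n w|] =
    [set w | exists2 i, (i <= N)%N & 3 * l <= `|T_ i w|].
  by apply/seteqP; split=> w [i iN h]; exists i => //; move: h; rewrite /T_ block.
have TB j w : (j <= N)%N -> T_ N w - T_ j w = \sum_(n + j <= k < n + N) Y k w.
  move=> jN; rewrite /T_ [X in X - _](@big_cat_nat _ _ _ (n + j) n (n + N))/=.
  - by rewrite addrAC subrr add0r.
  - by rewrite leq_addr.
  - by rewrite leq_add2l.
apply: (@le_trans _ _ (P [set w | (l <= `|T_ N w|)%R] + (v / l ^+ 2)%:E)%E).
  apply: etemadi => [j||j jN A F].
  - exact: (LT _ _).1.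
  - by rewrite lee_fin divr_ge0// sqr_ge0.
  split.
    (* [A] depends on noise indices below n + j, and [F] on those from n + j on. *)
    pose hp (x : past (n + j)) := val x; pose hf (x : future (n + j)) := val x.
    have mp i : (i <= j)%N -> measurable_fun setT
        (T_ i : g_sigma_algebraType (coord_events (X \o hp)) -> R).
      move=> ij; apply: measurable_sum_seq => k.
      rewrite mem_index_iota => /andP[_ kn]; apply: measurable_incr => z.
      have kj : ((k, z).1 < n + j)%N by rewrite (leq_trans kn)// leq_add2l.
      by exists (exist _ (k, z) kj).
    apply: (independent_sigma mX iX (h := hp) (h' := hf)).
    - exact: val_inj.
    - exact: val_inj.
    - move=> [x hx] [y hy] /=; apply/eqP => e.
      by rewrite /hp /hf /= in e; have := hx; rewrite e ltnNge hy.
    - suff : measurable (A : set (g_sigma_algebraType (coord_events (X \o hp)))) by [].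
      have mnp i : (i <= j)%N -> measurable_fun setT ((fun w => `|T_ i w|) :
          g_sigma_algebraType (coord_events (X \o hp)) -> R).
        by move=> ij; apply: measurableT_comp => //; exact: mp.
      have -> : A = [set w | 3 * l <= `|T_ j w|] `&`
          \bigcap_(i in [set i | (i < j)%N]) [set w | `|T_ i w| < 3 * l].
        by apply/seteqP; split=> w [h h']; split=> // i ij; exact: h'.
      apply: measurableI; first exact: measurable_ge_set (mnp _ (leqnn j)).
      apply: bigcap_measurableType => i /= ij.
      by apply: measurable_lt_set; apply: mnp; exact: ltnW.
    - suff : measurable (F : set (g_sigma_algebraType (coord_events (X \o hf)))) by [].
      apply: measurable_ge_set; apply: measurableT_comp => //.
      rewrite (_ : (fun _ => _) = (fun w => \sum_(n + j <= k < n + N) Y k w)); last first.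
        by apply/funext => w; rewrite TB.
      apply: measurable_sum_seq => k; rewrite mem_index_iota => /andP[kn _].
      apply: measurable_incr => z.
      have kj : (n + j <= (k, z).1)%N by [].
      by exists (exist _ (k, z) kj).
  apply: (@le_trans _ _ (v / (2 * l) ^+ 2)%:E).
    apply: le_trans (chebyshev_sq _ _) _; [by rewrite mulr_gt0| |].
      rewrite (_ : (fun _ => _) = (fun w => \sum_(n + j <= k < n + N) Y k w))//.
      by apply/funext => w; rewrite TB.
    rewrite lee_fin ler_pM2r ?invr_gt0 ?exprn_gt0 ?mulr_gt0//.
    rewrite (_ : (fun _ => _) = (fun w => (\sum_(n + j <= k < n + N) Y k w) ^+ 2)).
      by rewrite noise_block_var// sub// ?leq_addr// leq_add2l.
    by apply/funext => w; rewrite TB.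
  rewrite lee_fin ler_wpM2l// lef_pV2 ?posrE ?exprn_gt0 ?mulr_gt0//.
  by rewrite lerXn2r ?nnegrE ?mulr_ge0// ?ltW//; lra.
have -> : 2 * v / l ^+ 2 = v / l ^+ 2 + v / l ^+ 2 by rewrite mulr_natl mulr2n mulrDl.
rewrite EFinD leeD2r//; apply: le_trans (chebyshev_sq l0 (LT _ _)) _.
by rewrite lee_fin ler_pM2r ?invr_gt0 ?exprn_gt0// noise_block_var// hv.
Qed.

Lemma noise_var_tail (e : R) : 0 < e -> exists n, forall m,
  \sum_(n <= k < n + m) Ex (fun w => Y k w ^+ 2) <= e.
Proof.
move=> e0; have [C hC] := noise_var_summable sp ap LX iX dX a b.
pose u k := Ex (fun w => Y k w ^+ 2).
have u0 k : 0 <= u k by apply: Ex_ge0 => w; exact: sqr_ge0.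
have nd : nondecreasing_seq (series u).
  by apply/nondecreasing_seqP => n; rewrite /series /= big_nat_recr//= lerDl.
have cu : cvgn (series u).
  apply: nondecreasing_is_cvgn => //.
  by exists C => _ [n _ <-]; rewrite /series /= big_mkord; exact: hC.
have cu' : series u @ \oo --> limn (series u) := cu.
move/cvgrPdist_lt : cu' => /(_ _ e0)[n _ hn].
exists n => m; have := hn n (leqnn n).
have := nondecreasing_cvgn_le nd cu (n + m)%N.
rewrite /series /= (@big_cat_nat _ _ _ n 0 (n + m))// ?leq_addr//=.
rewrite -/(series u n); set x := limn _ => h1 h2.
have := ler_norm (x - series u n); rewrite /series /= in h2 *; lra.
Qed.

(** Failure of the Cauchy property puts the sample point in some [bad l], where excursions of size 3
    l occur after every n. The maximal inequality, started where the variance tail is small, makes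
    each such event null. *)
Lemma noise_series_cvg : {ae P, forall w, cvgn (fun n => S n w)}.
Proof.
pose M (l : R) n N := [set w | exists2 i, (i <= N)%N & 3 * l <= `|S (n + i)%N w - S n w|].
have mS n : measurable_fun setT (S n) by apply: measurable_sum => k; exact: (LY k).1.
have mM l n N : measurable (M l n N).
  rewrite (_ : M l n N = \bigcup_(i in [set i | (i <= N)%N])
     [set w | 3 * l <= `|S (n + i)%N w - S n w|]).
    apply: bigcup_measurable => i _; apply: measurable_ge_set.
    by apply: measurableT_comp => //; exact: measurable_funB.
  by apply/seteqP; split=> w [i ? ?]; exists i.
pose bad l := \bigcap_n \bigcup_N M l n N.
have mbad l : measurable (bad l).
  by apply: bigcapT_measurable => n; apply: bigcupT_measurable => N.
have Pbad l : 0 < l -> P (bad l) = 0%E.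
  move=> l0; apply/eqP; rewrite eq_le measure_ge0 andbT.
  apply/lee_addgt0Pr => e e0; rewrite add0e.
  (* Chosen so that the bound 2 v / l^2 of [noise_maximal] equals e. *)
  have v0 : 0 < e * l ^+ 2 / 2 by rewrite !mulr_gt0// ?exprn_gt0 ?invr_gt0.
  have [n hn] := noise_var_tail v0.
  apply: (@le_trans _ _ (P (\bigcup_N M l n N))).
    apply: le_measure; rewrite ?inE//; first exact: bigcupT_measurable.
    by move=> w; apply.
  have nM : {homo M l n : i j / (i <= j)%N >-> (i <= j)%O}.
    move=> i j ij; apply/subsetPset => w [k ki h].
    by exists k => //; exact: leq_trans ij.
  have := nondecreasing_cvg_mu (mM l n) (bigcupT_measurable _ (mM l n)) nM (mu := P).
  move=> /cvg_lim <-//; apply: lime_le.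
    apply: ereal_nondecreasing_is_cvgn => i j ij.
    by apply: le_measure; rewrite ?inE//; exact/subsetPset/nM.
  near=> N; apply: le_trans (noise_maximal N l0 (ltW v0) hn) _.
  rewrite lee_fin (_ : 2 * _ / _ = e)//; field.
  by rewrite gt_eqF.
(* At l = 1/(3(r+1)) the excursions 3 l have size 1/(r+1), and countably many r decide the Cauchy
   criterion. *)
have : P.-negligible (\bigcup_r bad (r.+1%:R^-1 / 3)).
  apply: negligible_bigcup => r; exists (bad (r.+1%:R^-1 / 3)); split=> //.
  by apply: Pbad; rewrite divr_gt0.
apply: negligibleS => w /= nc; apply: contrapT => nb; apply: nc.
apply: cauchy_cvg; apply: cauchy_exP => e e0.
have [r hr] : exists r, (r.+1%:R^-1 : R) < e.
  have [N _ /(_ N (leqnn N))] := near_infty_natSinv_lt (PosNum e0).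
  by exists N.
have nbr : ~ bad (r.+1%:R^-1 / 3) w by move=> h; apply: nb; exists r.
move/existsNP: nbr => [n] /not_implyP[_ hn].
exists (S n w); exists n => // m /= nm; rewrite /ball /= distrC ltNge; apply/negP => h.
apply: hn; exists (m - n)%N => //; exists (m - n)%N => //.
rewrite subnKC// mulrC divfK//; exact: le_trans (ltW hr) h.
Unshelve. all: by end_near. Qed.

End noise_cvg.

(** * The mean ergodic theorem *)

Lemma ae_forall_countable d (T : measurableType d) (R : realType)
    (mu : {measure set T -> \bar R}) (I : countType) (Q : I -> T -> Prop) :
  (forall i, {ae mu, forall w, Q i w}) -> {ae mu, forall w, forall i, Q i w}.
Proof.
move=> QI.
have /ae_foralln : forall n, {ae mu, forall w,
    if unpickle n is Some i then Q i w else True}.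
  by move=> n; case: (unpickle n) => [i|]; [exact: QI|exact: aeW].
by apply: filterS => w h i; have := h (pickle i); rewrite pickleK.
Qed.

Lemma sqrD_le2 (R : realDomainType) (x y : R) : (x + y) ^+ 2 <= 2 * x ^+ 2 + 2 * y ^+ 2.
Proof. by have := sqr_ge0 (x - y); nra. Qed.

Section ergodic.
Context {R : realType} {d : nat} {dO : measure_display} {O : measurableType dO}.
Variable P : probability O R.
Notation Ex := (Ex P). Notation L2 := (L2 P). Notation Int := (Int P).
Notation cspace := (g_sigma_algebraType
  (coord_events (fun (j : site d * 'I_d) (c : site d * 'I_d -> R) => c j))).
Implicit Types Phi Psi : cspace -> R.

Variable zeta : O -> cfg R d.
Hypotheses (mz : forall j, measurable_fun setT (fun w => zeta w j))
  (iz : shift_invariant_law P zeta) (ez : shift_ergodic_law P zeta).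

Lemma cfg_shiftD x y (c : cfg R d) : cfg_shift x (cfg_shift y c) = cfg_shift (x + y) c.
Proof. by apply/funext => j; rewrite /cfg_shift /= addrA. Qed.

Lemma cfg_shift0 (c : cfg R d) : cfg_shift 0 c = c.
Proof. by apply/funext => -[x i]; rewrite /cfg_shift /= addr0. Qed.

Lemma measurable_cfg_shift x : measurable_fun setT (cfg_shift x : cspace -> cspace).
Proof.
apply: (@measurable_family R _ cspace _ (fun j c => c (j.1 + x, j.2))) => j.
exact: measurable_coord.
Qed.

Lemma measurable_zeta : measurable_fun setT (zeta : O -> cspace).
Proof. exact: (@measurable_family R _ O _ (fun j w => zeta w j)). Qed.

Lemma shift_law_Ex Phi x : measurable_fun setT Phi ->
  Ex (fun w => Phi (cfg_shift x (zeta w))) = Ex (fun w => Phi (zeta w)).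
Proof.
move=> mPhi; rewrite /Ex /Rintegral; congr fine.
apply: (same_law_integral (X := fun j w => cfg_shift x (zeta w) j)
  (Y := fun j w => zeta w j) (F := EFin \o Phi)).
- by move=> j; exact: (mz (j.1 + x, j.2)).
- by [].
- by move=> A mA; exact: (iz x mA).
- exact/measurable_EFinP.
Qed.

Definition shift_field Phi : site d -> O -> R := fun x w => Phi (cfg_shift x (zeta w)).

Lemma shift_field_measurable Phi x :
  measurable_fun setT Phi -> measurable_fun setT (shift_field Phi x).
Proof.
move=> mPhi.
exact: (measurableT_comp mPhi (measurableT_comp (measurable_cfg_shift x) measurable_zeta)).
Qed.

Lemma shift_field_stat2 Phi C : measurable_fun setT Phi ->
  (forall c, `|Phi c| <= C) -> stat2 P (shift_field Phi).
Proof.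
move=> mPhi hC; split=> [x|a x y].
  apply: (@L2_bounded _ _ _ P _ C); first exact: shift_field_measurable.
  by move=> w; exact: hC.
rewrite -[RHS](shift_law_Ex (Phi := fun c => Phi (cfg_shift x c) * Phi (cfg_shift y c)) a).
  by congr (Ex _); apply/funext => w; rewrite !cfg_shiftD.
by apply: measurable_funM; exact: (measurableT_comp mPhi (measurable_cfg_shift _)).
Qed.

(** Midpoints are the only convex combinations the parallelogram law needs, and the inductive form
    lets every property of the hull be proved by rule induction. Elements are functions of the
    configuration, so that shifts can be composed with them. *)
Inductive hull (Phi0 : cspace -> R) : (cspace -> R) -> Prop :=
| hull_base : hull Phi0 Phi0
| hull_shift a Phi : hull Phi0 Phi -> hull Phi0 (fun c => Phi (cfg_shift a c))
| hull_mid Phi Psi : hull Phi0 Phi -> hull Phi0 Psi ->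
    hull Phi0 (fun c => 2^-1 * (Phi c + Psi c)).

Variables (Phi0 : cspace -> R) (C : R).
Hypotheses (mPhi0 : measurable_fun setT Phi0) (bPhi0 : forall c, `|Phi0 c| <= C)
  (EPhi0 : Ex (fun w => Phi0 (zeta w)) = 0).

Lemma hull_measurable Phi : hull Phi0 Phi -> measurable_fun setT Phi.
Proof.
elim=> [//|a Psi _ mPsi|Psi Psi' _ mPsi _ mPsi'].
  exact: (measurableT_comp mPsi (measurable_cfg_shift a)).
by apply: measurable_funM => //; exact: measurable_funD.
Qed.

Lemma hull_bounded Phi : hull Phi0 Phi -> forall c, `|Phi c| <= C.
Proof.
elim=> [//|a Psi _ bPsi c //|Psi Psi' _ b _ b' c].
rewrite normrM ger0_norm//; have := ler_normD (Psi c) (Psi' c).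
by have := b c; have := b' c; move: `|_| `|_| `|_|=> x y z; lra.
Qed.

Lemma hull_stat2 Phi : hull Phi0 Phi -> stat2 P (shift_field Phi).
Proof.
move=> h; exact: (shift_field_stat2 (hull_measurable h) (hull_bounded h)).
Qed.

Lemma hull_L2 Phi : hull Phi0 Phi -> L2 (fun w => Phi (zeta w)).
Proof.
move=> /hull_stat2[+ _] => /(_ 0); rewrite /shift_field.
by under [in X in X -> _]eq_fun do rewrite cfg_shift0.
Qed.

Lemma hull_mean0 Phi : hull Phi0 Phi -> Ex (fun w => Phi (zeta w)) = 0.
Proof.
elim=> [//|a Psi hP IH|Psi Psi' h IH h' IH'].
  by rewrite shift_law_Ex//; exact: hull_measurable.
rewrite ExZ ?ExD ?IH ?IH' ?addr0 ?mulr0//;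
  by first [exact: L2_int (hull_L2 _) | apply: IntD; exact: L2_int (hull_L2 _)].
Qed.

Let N Phi := Ex (fun w => Phi (zeta w) ^+ 2).

Let delta := inf [set N Phi | Phi in hull Phi0].

Lemma hull_inf : has_inf [set N Phi | Phi in hull Phi0].
Proof.
split; first by exists (N Phi0), Phi0 => //; exact: hull_base.
by exists 0 => _ [Phi _ <-]; apply: Ex_ge0 => w; exact: sqr_ge0.
Qed.

(** The midpoint is again in the hull, so E(Phi + Psi)^2, which is four times its second moment, is
    at least 4 delta. *)
Lemma hull_parallelogram Phi Psi : hull Phi0 Phi -> hull Phi0 Psi ->
  Ex (fun w => (Phi (zeta w) - Psi (zeta w)) ^+ 2) <= 2 * N Phi + 2 * N Psi - 4 * delta.
Proof.
move=> h h'; have Lp := hull_L2 h; have Lq := hull_L2 h'.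
have LD := L2D Lp Lq.
have hm := hull_mid h h'.
have dm : delta <= N (fun c => 2^-1 * (Phi c + Psi c)).
  by apply: ge_inf; [exact: hull_inf.2|exists (fun c => 2^-1 * (Phi c + Psi c))].
have E : N (fun c => 2^-1 * (Phi c + Psi c)) =
    4^-1 * Ex (fun w => (Phi (zeta w) + Psi (zeta w)) ^+ 2).
  rewrite -ExZ; last exact: L2_sq.
  by congr (Ex _); apply/funext => w; field.
suff -> : Ex (fun w => (Phi (zeta w) - Psi (zeta w)) ^+ 2) =
    2 * N Phi + 2 * N Psi - Ex (fun w => (Phi (zeta w) + Psi (zeta w)) ^+ 2).
  by move: dm; rewrite E; move: (Ex _) (N _) (N _) => x y z; lra.
rewrite /N -!ExZ; [|exact: L2_sq|exact: L2_sq].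
rewrite -ExD; [|by apply: IntZ; exact: L2_sq|by apply: IntZ; exact: L2_sq].
rewrite -ExB; last exact: L2_sq.
  by congr (Ex _); apply/funext => w; ring.
by apply: IntD; apply: IntZ; exact: L2_sq.
Qed.

(* A minimising sequence in the hull is Cauchy by the parallelogram law, and
   its limit is shift invariant, hence constant by ergodicity. *)
Lemma hull_inf_eq0 : delta = 0.
Proof.
have q0 n : 0 < (4^-1 : R) ^+ n by rewrite exprn_gt0.
(* The rate 4^-n makes consecutive L2 distances at most 2 * 2^-n, hence summable: the sequence
   converges almost surely along itself, without passing to a subsequence. *)
have /choice[F hF] : forall n, exists Phi : cspace -> R,
    hull Phi0 Phi /\ N Phi < delta + 4^-1 ^+ n.
  move=> n; have [_ [Phi h <-] lt] := inf_adherent (q0 n) hull_inf.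
  by exists Phi.
have hull_F n := (hF n).1; have NF n := (hF n).2.
have LF n := hull_L2 (hull_F n).
have geo (f : nat -> O -> R) (K : R) : (forall n, L2 (f n)) -> 0 <= K ->
    (forall n, Ex (fun w => f n w ^+ 2) <= (K * 2^-1 ^+ n) ^+ 2) ->
    {ae P, forall w, cvgn (series (fun n => `|f n w|))}.
  move=> Lf K0 fK; apply: (ae_summable (P := P) (K := K * 2)).
    by move=> n; exact: L2_int.
  move=> n; apply: (@le_trans _ _ (\sum_(k < n) K * 2^-1 ^+ k)).
    apply: ler_sum => k _; apply: le_trans (Ex_norm_le_sqrt (Lf k)) _.
    rewrite -[leRHS]ger0_norm ?mulr_ge0 ?exprn_ge0// -sqrtr_sqr ler_sqrt//.
    exact: sqr_ge0.
  rewrite -mulr_sumr ler_wpM2l//.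
  suff -> : \sum_(k < n) (2^-1 : R) ^+ k = 2 - 2 * 2^-1 ^+ n.
    have : 0 <= (2^-1 : R) ^+ n by rewrite exprn_ge0.
    by move: (_ ^+ n) => x; nra.
  elim: n => [|n IH]; first by rewrite big_ord0 expr0; ring.
  by rewrite big_ord_recr /= IH exprS; field.
have sq4 n : (2^-1 ^+ n) ^+ 2 = (4^-1 : R) ^+ n.
  by rewrite -exprM mulnC exprM; congr (_ ^+ _); field.

have aeC : {ae P, forall w, cvgn (fun n => F n (zeta w))}.
  have : {ae P, forall w, cvgn (series (fun n => `|F n.+1 (zeta w) - F n (zeta w)|))}.
    apply: (geo (fun n w => F n.+1 (zeta w) - F n (zeta w)) 2) => [n|//|n].
      exact: L2B.
    apply: le_trans (hull_parallelogram (hull_F _) (hull_F _)) _.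
    rewrite exprMn sq4; have := NF n.+1; have := NF n; have := q0 n; rewrite exprS.
    by move: (N _) (N _) (_ ^+ n) => x y z; lra.
  apply: filterS => w /normed_cvg h.
  rewrite (_ : (fun n => F n (zeta w)) =
    (fun n => F 0%N (zeta w) + series (telescope (fun n => F n (zeta w))) n)).
    by apply: is_cvgD => //; exact: is_cvg_cst.
  by apply/funext => n; rewrite -(eq_sum_telescope (fun n => F n (zeta w))).
(* The shift of [F n] lies in the hull with the same second moment, so it is just as close to
   minimal and the parallelogram law forces it towards [F n]. *)
have aeD x : {ae P, forall w,
    (F n (cfg_shift x (zeta w)) - F n (zeta w)) @[n --> \oo] --> 0}.
  have : {ae P, forall w, cvgn (series (fun n => `|F n (cfg_shift x (zeta w)) - F n (zeta w)|))}.
    apply: (geo (fun n w => F n (cfg_shift x (zeta w)) - F n (zeta w)) 2) => [n|//|n].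
      apply: L2B => //; exact: (hull_L2 (hull_shift x (hull_F n))).
    apply: le_trans (hull_parallelogram (hull_shift x (hull_F n)) (hull_F n)) _.
    rewrite exprMn sq4; have := NF n.
    rewrite (_ : N (fun c => F n (cfg_shift x c)) = N (F n)).
      by move: (N _) (_ ^+ n) => u v; lra.
    apply: (shift_law_Ex (Phi := fun c => F n c ^+ 2)).
    by apply: measurable_funX; exact: hull_measurable.
  by apply: filterS => w /cvg_series_cvg_0 h; apply/norm_cvg0P.

(* The upper limit is defined and measurable everywhere, and almost surely it is the limit. *)
pose W w := limn_sup (fun n => F n (zeta w)).
have mF n : measurable_fun setT (fun w => F n (zeta w)) by exact: (LF n).1.
have bF n c : `|F n c| <= C by exact: hull_bounded.
have mW : measurable_fun setT W.
  apply: measurable_fun_limn_sup => // w _.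
    by exists C => _ [n _ <-]; exact: le_trans (ler_norm _) (bF _ _).
  by exists (- C) => _ [n _ <-]; have := bF n (zeta w); rewrite ler_norml => /andP[].
have aeW' : {ae P, forall w, F n (zeta w) @[n --> \oo] --> W w}.
  apply: filterS aeC => w h.
  have h' : F n (zeta w) @[n --> \oo] --> limn (fun n => F n (zeta w)) by [].
  by rewrite /W /limn_sup (cvg_lim _ (cvg_sups h')).
(* The condition is that the upper limit of [F n] at every shift of c is at most 0. Quantifying over
   all shifts makes the event invariant as a set, as [shift_ergodic_law] demands, while almost
   surely it amounts to W <= 0. *)
pose A : set cspace := [set c | forall x (r : nat), exists n0, forall n, (n0 <= n)%N ->
  F n (cfg_shift x c) <= r.+1%:R^-1].
have mA : measurable A.
  rewrite (_ : A = \bigcap_x \bigcap_r \bigcup_n0 \bigcap_(n in [set n | (n0 <= n)%N])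
      [set c | F n (cfg_shift x c) <= r.+1%:R^-1]); last first.
    apply/seteqP; split=> c.
      by move=> h x _ r _; have [n0 hn] := h x r; exists n0 => // n /= nn; exact: hn.
    by move=> h x r; have [n0 _ hn] := h x Logic.I r Logic.I; exists n0 => n nn; exact: hn.
  rewrite -[X in measurable X]setCK setC_bigcap; apply: measurableC.
  apply: countable_bigcupT_measurable => [|x]; first exact: countableP.
  apply: measurableC; apply: bigcap_measurableType => r _.
  apply: bigcup_measurable => n0 _; apply: bigcap_measurableType => n _.
  rewrite (_ : [set c | _] = [set c | - r.+1%:R^-1 <= - F n (cfg_shift x c)]).
    apply: measurable_ge_set; apply: measurable_funN => //.
    exact: (measurableT_comp (hull_measurable (hull_F n)) (measurable_cfg_shift x)).
  by apply/seteqP; split=> c /=; rewrite lerN2.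
have iA a : cfg_shift a @^-1` A = A.
  apply/seteqP; split=> c h x r.
    by have := h (x - a) r; rewrite cfg_shiftD subrK.
  by have := h (x + a) r; rewrite cfg_shiftD.
have aeA : {ae P, forall w, A (zeta w) <-> W w <= 0}.
  have := ae_forall_countable aeD; apply: filterS2 aeW' => w hW hD.
  have hx x : F n (cfg_shift x (zeta w)) @[n --> \oo] --> W w.
    rewrite -[W w]add0r; rewrite (_ : (fun n => _) = (fun n =>
      (F n (cfg_shift x (zeta w)) - F n (zeta w)) + F n (zeta w))).
      exact: cvgD (hD x) hW.
    by apply/funext => n; rewrite subrK.
  split=> [hA|W0 x r].
    rewrite leNgt; apply/negP => W0.
    have [r hr] : exists r, (r.+1%:R^-1 : R) < W w.
      have [n _ /(_ n (leqnn n))] := near_infty_natSinv_lt (PosNum W0).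
      by exists n.
    have [n0 hn] := hA 0 r.
    have : W w <= r.+1%:R^-1.
      rewrite -(cvg_lim _ hW)//; apply: limr_le; first exact: (cvgP _ hW).
      by exists n0 => // n /= nn; have := hn n nn; rewrite cfg_shift0.
    by rewrite leNgt hr.
  have r0 : W w < r.+1%:R^-1 by rewrite (le_lt_trans W0).
  have [n0 _ hn] := (cvgr_lt _ (hx x)) _ r0.
  by exists n0 => n nn; apply: ltW; exact: hn.
have EW : Ex W = 0.
  have h := Ex_cvg mF mW (fun n w => bF n (zeta w)) aeW'.
  apply: (cvg_unique _ h) => //.
  rewrite (_ : (fun n => _) = (fun=> 0)); first exact: cvg_cst.
  by apply/funext => n; exact: hull_mean0.
(* Ergodicity gives W one sign almost surely: W > 0 if A is null, W <= 0 if A is full. Together with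
   mean zero, either case yields E|W| = 0, so the single level 0 suffices. *)
have EaW : Ex (fun w => `|W w|) = 0.
  have maW : measurable_fun setT (fun w => `|W w|) by exact: measurableT_comp.
  have mAz : measurable (zeta @^-1` A).
    by rewrite -[X in measurable X]setTI; apply: measurable_zeta.
  have [PA|PA] := ez mA iA.
    rewrite -EW; apply: Ex_ae => //.
    have : {ae P, forall w, ~ A (zeta w)}.
      exists (zeta @^-1` A); split=> // w /= /contrapT; exact.
    apply: filterS2 aeA => w hw nA; rewrite ger0_norm//.
    by apply: ltW; rewrite ltNge; apply/negP => /hw.
  have -> : 0 = Ex (fun w => (-1) * W w).
    have h : Ex (fun w => (-1) * F n (zeta w)) @[n --> \oo] --> Ex (fun w => (-1) * W w).
      apply: (Ex_cvg (C := C)).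
      - by move=> n; apply: measurable_funM.
      - exact: measurable_funM.
      - by move=> n w; rewrite mulN1r normrN.
      - by apply: filterS aeW' => w hw; apply: cvgMr.
    apply: (cvg_unique _ _ h) => //.
    rewrite (_ : (fun n => _) = (fun=> 0)); first exact: cvg_cst.
    by apply/funext => n; rewrite ExZ ?hull_mean0 ?mulr0//; exact: L2_int.
  apply: Ex_ae => //; first exact: measurable_funM.
  have : {ae P, forall w, A (zeta w)}.
    exists (~` (zeta @^-1` A)); split=> //; first exact: measurableC.
    by rewrite probability_setC//; have -> : P (zeta @^-1` A) = 1%E := PA; rewrite subee.
  apply: filterS2 aeA => w hw wA; rewrite ler0_norm ?mulN1r//; exact/hw.
apply/eqP; rewrite eq_le; apply/andP; split; last first.
  by apply: lb_le_inf; [exact: hull_inf.1|move=> _ [Phi _ <-]; apply: Ex_ge0 => w; exact: sqr_ge0].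
have h1 : Ex (fun w => `|F n (zeta w)|) @[n --> \oo] --> 0.
  rewrite -EaW; apply: (Ex_cvg (C := C)).
  - by move=> n; apply: measurableT_comp.
  - exact: measurableT_comp.
  - by move=> n w; rewrite normr_id.
  - by apply: filterS aeW' => w h; exact: cvg_norm.
(* Boundedness leads back to second moments: delta <= E F_n^2 <= C E|F_n|, which tends to 0. *)
have C0 : 0 <= C by exact: le_trans (normr_ge0 _) (bF 0%N (zeta point)).
have h2 : C * Ex (fun w => `|F n (zeta w)|) @[n --> \oo] --> 0.
  by rewrite -(mulr0 C); apply: cvgMr.
rewrite -(cvg_lim _ h2)//; apply: limr_ge; first exact: (cvgP _ h2).
apply: nearW => n; apply: (@le_trans _ _ (N (F n))).
  by apply: ge_inf; [exact: hull_inf.2|exists (F n)].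
have IaF : Int (fun w => `|F n (zeta w)|) by apply: Int_norm; exact: L2_int.
rewrite -ExZ//; apply: Ex_le; [exact: L2_sq|exact: IntZ|] => w.
by rewrite -(real_normK (num_real _)) expr2 ler_wpM2r.
Qed.

Lemma hull_small e : 0 < e -> exists2 Phi, hull Phi0 Phi & N Phi < e.
Proof.
move=> e0; have [_ [Phi h <-]] := inf_adherent e0 hull_inf.
by rewrite -/delta hull_inf_eq0 add0r; exists Phi.
Qed.

Variables (s : seq (site d)) (p : site d -> R).
Hypotheses (sp : ker_on s p) (ap : strongly_aperiodic p).
Notation A k Phi x := (avgF s p k (shift_field Phi) x).

Lemma cvg0_le (u v : nat -> R) : (forall n, 0 <= u n) -> (forall n, u n <= v n) ->
  v @ \oo --> 0 -> u @ \oo --> 0.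
Proof.
move=> u0 uv v0; apply: (squeeze_cvgr _ (cvg_cst 0) v0).
by apply: nearW => n; rewrite u0 uv.
Qed.

(** All elements of the hull become indistinguishable under A^k: a shift by a moves the evaluation
    point from 0 to a, which [increments_to0] makes negligible, and a midpoint is handled by
    convexity. *)
Lemma hull_avg_close Phi : hull Phi0 Phi ->
  Ex (fun w => (A k Phi 0 w - A k Phi0 0 w) ^+ 2) @[k --> \oo] --> 0.
Proof.
have LA Psi k x : hull Phi0 Psi -> L2 (A k Psi x).
  by move=> h; apply: avgF_L2; exact: (hull_stat2 h).1.
have LB := LA _ _ _ (hull_base Phi0).
have cvg2 (u v : nat -> R) : u @ \oo --> 0 -> v @ \oo --> 0 ->
    (2 * u n + 2 * v n) @[n --> \oo] --> 0.
  move=> hu hv; rewrite -[0](addr0 0) -[in X in _ --> X + _](mulr0 2).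
  rewrite -[in X in _ --> _ + X](mulr0 2).
  by apply: cvgD; apply: cvgMr.
elim=> [|a Psi h IH|Psi Psi' h IH h' IH'].
- rewrite (_ : (fun _ => _) = (fun=> 0)); first exact: cvg_cst.
  apply/funext => k; rewrite -[RHS](Ex_cst P); congr (Ex _); apply/funext => w.
  by rewrite subrr expr0n.
- apply: cvg0_le (cvg2 _ _ (increments_to0 sp ap a 0 (hull_stat2 h)) IH) => k.
    by apply: Ex_ge0 => w; exact: sqr_ge0.
  have L1 := LA Psi k _ h.
  rewrite -!ExZ; [|by apply: L2_sq; exact: L2B..].
  rewrite -ExD; [|by apply: IntZ; apply: L2_sq; exact: L2B..].
  apply: Ex_le => [||w].
  + by apply: L2_sq; apply: L2B => //; exact: LA (hull_shift a h).
  + by apply: IntD; apply: IntZ; apply: L2_sq; exact: L2B.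
  + rewrite (_ : A k (fun c => Psi (cfg_shift a c)) 0 w = A k Psi a w).
      rewrite (_ : _ - A k Phi0 0 w = (A k Psi a w - A k Psi 0 w) +
        (A k Psi 0 w - A k Phi0 0 w)); first exact: sqrD_le2.
      by rewrite addrA subrK.
    rewrite /avgF -[in RHS](add0r a) -iter_avg_shift; apply: eq_iter_avg => y.
    by rewrite /shift_field cfg_shiftD addrC.
- apply: cvg0_le (cvg2 _ _ IH IH') => k.
    by apply: Ex_ge0 => w; exact: sqr_ge0.
  have L1 := LA Psi k _ h; have L1' := LA Psi' k _ h'.
  rewrite -!ExZ; [|by apply: L2_sq; exact: L2B..].
  rewrite -ExD; [|by apply: IntZ; apply: L2_sq; exact: L2B..].
  apply: Ex_le => [||w].
  + by apply: L2_sq; apply: L2B => //; exact: LA (hull_mid h h').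
  + by apply: IntD; apply: IntZ; apply: L2_sq; exact: L2B.
  + rewrite (_ : A k _ 0 w = 2^-1 * (A k Psi 0 w + A k Psi' 0 w)).
      move: (A k Psi 0 w) (A k Psi' 0 w) (A k Phi0 0 w) => x y z.
      have := sqr_ge0 (x - y); have := sqr_ge0 (x - z); have := sqr_ge0 (y - z).
      rewrite !expr2; nra.
    by rewrite /avgF -iter_avgD -iter_avgZ.
Qed.

Lemma ergodic_avg_L2 : Ex (fun w => A k Phi0 0 w ^+ 2) @[k --> \oo] --> 0.
Proof.
apply/cvgrPdist_le => e e0.
(* The bound is 2 E(A^k Phi)^2 plus twice the squared distance; contraction bounds the first moment
   by [N Phi], and each of the two is below e/4. *)
have e4 : 0 < e / 4 by rewrite divr_gt0.
have [Phi h NP] := hull_small e4.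
have /cvgrPdist_le /(_ _ e4)[n _ hn] := hull_avg_close h.
exists n => // k /= /hn; rewrite !sub0r !normrN => {}hn.
have E0 (f : O -> R) : 0 <= Ex (fun w => f w ^+ 2) by apply: Ex_ge0 => w; exact: sqr_ge0.
rewrite !ger0_norm// in hn *.
have L1 : L2 (A k Phi 0) by apply: avgF_L2; exact: (hull_stat2 h).1.
have L0 : L2 (A k Phi0 0) by apply: avgF_L2; exact: (hull_stat2 (hull_base _)).1.
have : Ex (fun w => A k Phi0 0 w ^+ 2) <= 2 * Ex (fun w => A k Phi 0 w ^+ 2) +
    2 * Ex (fun w => (A k Phi 0 w - A k Phi0 0 w) ^+ 2).
  rewrite -!ExZ; [|by apply: L2_sq; exact: L2B|exact: L2_sq].
  rewrite -ExD; [|by apply: IntZ; exact: L2_sq|by apply: IntZ; apply: L2_sq; exact: L2B].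
  apply: Ex_le => [||w]; first exact: L2_sq.
    by apply: IntD; apply: IntZ; apply: L2_sq => //; exact: L2B.
  rewrite -[X in X ^+ 2 <= _](subKr (A k Phi 0 w)) -[leRHS]addr0.
  by have := sqrD_le2 (A k Phi 0 w) (- (A k Phi 0 w - A k Phi0 0 w)); rewrite sqrrN addr0.
have := avgF_contract sp k (hull_stat2 h).
rewrite (_ : Ex (fun w => shift_field Phi 0 w ^+ 2) = N Phi); last first.
  by congr (Ex _); apply/funext => w; rewrite /shift_field cfg_shift0.
by move: hn NP; move: (N _) (Ex _) (Ex _) (Ex _) => x y z t; lra.
Qed.


End ergodic.

(** * Truncation and the ergodic theorem in L1 *)

Section truncation.
Context {R : realType}.

Definition trunc (K v : R) := Num.max (- K) (Num.min K v).

Lemma trunc_bounded K v : 0 <= K -> `|trunc K v| <= K.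
Proof.
move=> K0; rewrite ler_norml /trunc le_max lexx /= ge_max ge_min lexx /= andbT.
by rewrite (le_trans _ K0)// oppr_le0.
Qed.

Lemma trunc_dist K v : 0 <= K -> `|v - trunc K v| <= `|v|.
Proof.
move=> K0; rewrite /trunc.
have [h|h] := leP K v.
  rewrite max_r; last by lra.
  rewrite ger0_norm ?subr_ge0// ger0_norm ?(le_trans K0)//; lra.
have [h'|h'] := leP v (- K); last by rewrite subrr normr0 normr_ge0.
rewrite opprK ler0_norm; last by lra.
rewrite ler0_norm; lra.
Qed.

Lemma trunc_id K v : `|v| <= K -> trunc K v = v.
Proof.
rewrite ler_norml => /andP[h1 h2]; rewrite /trunc.
by rewrite [Num.min _ _]min_r// max_r.
Qed.

Lemma cvg_trunc v : trunc n%:R v @[n --> \oo] --> v.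
Proof.
apply: cvg_near_cst; near=> n; apply: trunc_id.
by near: n; exact: nbhs_infty_ger.
Unshelve. all: by end_near. Qed.

Lemma measurable_trunc dT (T : measurableType dT) K (f : T -> R) :
  measurable_fun setT f -> measurable_fun setT (fun w => trunc K (f w)).
Proof.
move=> mf; apply: measurable_maxr; first exact: measurable_cst.
by apply: measurable_minr => //; exact: measurable_cst.
Qed.

End truncation.

Section ergodicL1.
Context {R : realType} {d : nat} {dO : measure_display} {O : measurableType dO}.
Variable P : probability O R.
Notation Ex := (Ex P). Notation L2 := (L2 P). Notation Int := (Int P).
Variables (s : seq (site d)) (p : site d -> R).
Hypotheses (sp : ker_on s p) (ap : strongly_aperiodic p).

(** Averaging with weights of total mass 1 cannot increase a bound common to all sites, so the
    truncation error stays uniform in k. *)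
Lemma avgF_L1 (V : site d -> O -> R) r k x :
  (forall y, Int (V y)) -> (forall y, Ex (fun w => `|V y w|) <= r) ->
  Int (avgF s p k V x) /\ Ex (fun w => `|avgF s p k V x w|) <= r.
Proof.
move=> IV Vr; have [_ _ p0 p1] := sp; elim: k x => [|k IH] x; first by split.
have IA y : Int (avgF s p k V y) by have [] := IH y.
have II : Int (avgF s p k.+1 V x).
  by apply: (@Int_sum _ _ _ P _ s (fun z w => p z * avgF s p k V (x + z) w)) => z _; exact: IntZ.
split=> //.
apply: (@le_trans _ _ (Ex (fun w => \sum_(z <- s) p z * `|avgF s p k V (x + z) w|))).
  apply: Ex_le; first exact: Int_norm.
    by apply: Int_sum => z _; apply: IntZ; exact: Int_norm.
  move=> w; rewrite avgF_S; apply: le_trans (ler_norm_sum _ _ _) _.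
  by apply: ler_sum => z _; rewrite normrM ger0_norm.
rewrite Ex_sum; last by move=> z _; apply: IntZ; exact: Int_norm.
rewrite -[leRHS]mul1r -p1 mulr_suml; apply: ler_sum => z _.
rewrite ExZ; last exact: Int_norm.
by rewrite ler_wpM2l//; have [] := IH (x + z).
Qed.

Variable zeta : O -> cfg R d.
Hypotheses (mz : forall j, measurable_fun setT (fun w => zeta w j))
  (iz : shift_invariant_law P zeta) (ez : shift_ergodic_law P zeta)
  (Iz : forall j, Int (fun w => zeta w j)) (z0 : forall j, Ex (fun w => zeta w j) = 0).

(** The field is split into a truncation residue, small in L1 at every k; a bounded centred part,
    covered by [ergodic_avg_L2]; and the truncated mean, which averaging leaves fixed and which is
    small because [zeta] itself has mean 0. *)
Lemma ergodic_avg_L1 x i :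
  Ex (fun w => `|avgF s p k (fun y w => zeta w (y, i)) x w|) @[k --> \oo] --> 0.
Proof.
pose tr n v : R := trunc n%:R v.
pose m n := Ex (fun w => tr n (zeta w (0, i))).
pose r n := Ex (fun w => `|zeta w (0, i) - tr n (zeta w (0, i))|).
have n0 n : 0 <= n%:R :> R by [].
have mtr n j : measurable_fun setT (fun w => tr n (zeta w j)) by exact: measurable_trunc.
have Itr n j : Int (fun w => tr n (zeta w j)).
  by apply: (@Int_bounded _ _ _ P _ n%:R) => // w; exact: trunc_bounded.
have r0 : r n @[n --> \oo] --> 0.
  rewrite -[0](Ex_cst P); apply: (Ex_cvg_dom (g := fun w => `|zeta w (0, i)|)).
  - by move=> n; apply: measurableT_comp => //; exact: measurable_funB.
  - exact: measurable_cst.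
  - exact: Int_norm.
  - by move=> n w; rewrite normr_id; exact: trunc_dist.
  - apply: aeW => w; apply/norm_cvg0P; rewrite -[X in _ --> X](subrr (zeta w (0, i))).
    apply: (@cvgB _ _ _ _ _ (fun=> zeta w (0, i)) (fun n => tr n (zeta w (0, i)))).
      exact: cvg_cst.
    exact: cvg_trunc.
have mr n : `|m n| <= r n.
  rewrite /m -[Ex _]opprK -[X in - X]add0r -(z0 (0, i)) -ExB// normrN.
  by apply: Ex_norm; exact: IntB.
have rx n y : Ex (fun w => `|zeta w (y, i) - tr n (zeta w (y, i))|) = r n.
  rewrite -[RHS](shift_law_Ex mz iz (Phi := fun c => `|c (0, i) - tr n (c (0, i))|) y).
    by congr (Ex _); apply/funext => w; rewrite /cfg_shift /= add0r.
  apply: measurableT_comp => //; apply: measurable_funB; first exact: measurable_coord.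
  by apply: measurable_trunc; exact: measurable_coord.
apply/cvgrPdist_le => e e0.
(* Residue, centred part and mean contribute at most e/4 each. *)
have e4 : 0 < e / 4 by rewrite divr_gt0.
move/cvgrPdist_le : r0 => /(_ _ e4)[n _ /(_ n (leqnn n))].
rewrite sub0r normrN ger0_norm; last by apply: Ex_ge0 => w; exact: normr_ge0.
move=> rn.
pose Phi (c : site d * 'I_d -> R) := tr n (c (0, i)) - m n.
have bPhi c : `|Phi c| <= n%:R + `|m n|.
  by apply: le_trans (ler_normB _ _) _; rewrite lerD2r trunc_bounded.
have mPhi : measurable_fun setT (Phi : g_sigma_algebraType (coord_events
    (fun (j : site d * 'I_d) (c : site d * 'I_d -> R) => c j)) -> R).
  apply: measurable_funB => //; apply: measurable_trunc; exact: measurable_coord.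
have EPhi : Ex (fun w => Phi (zeta w)) = 0.
  by rewrite ExB// ?Ex_cst ?subrr//; exact: Int_cst.
have SP := shift_field_stat2 mz iz mPhi bPhi.
have := ergodic_avg_L2 mz iz ez mPhi bPhi EPhi sp ap.
(* The centred part is controlled in second moment; the square root in [Ex_norm_le_sqrt] brings this
   back to e/4. *)
have q0 : 0 < (e / 4) ^+ 2 by rewrite exprn_gt0.
move/cvgrPdist_le => /(_ _ q0)[N _ hN]; exists N => // k /= /hN.
have E0 : 0 <= Ex (fun w => avgF s p k (shift_field zeta Phi) 0 w ^+ 2).
  by apply: Ex_ge0 => w; exact: sqr_ge0.
rewrite !sub0r !normrN ger0_norm// ger0_norm; last first.
  by apply: Ex_ge0 => w; exact: normr_ge0.
move=> hk.
have LA : L2 (avgF s p k (shift_field zeta Phi) x) by apply: avgF_L2; exact: SP.1.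
have h1 : Ex (fun w => `|avgF s p k (shift_field zeta Phi) x w|) <= e / 4.
  apply: le_trans (Ex_norm_le_sqrt LA) _.
  rewrite (stat2_sq x 0 (avgF_stat2 _ _ k SP)).
  rewrite -[leRHS]ger0_norm; last exact: ltW.
  by rewrite -sqrtr_sqr ler_sqrt// sqr_ge0.
pose V y w := zeta w (y, i) - tr n (zeta w (y, i)).
have IV y : Int (V y) by exact: IntB.
have Vr y : Ex (fun w => `|V y w|) <= e / 4 by rewrite rx.
have [IA h2] := avgF_L1 k x IV Vr.
have E w : avgF s p k (fun y w => zeta w (y, i)) x w =
    avgF s p k V x w + avgF s p k (shift_field zeta Phi) x w + m n.
  rewrite -[m n](iter_avg_cst k (m n) x sp) /avgF -!iter_avgD.
  apply: eq_iter_avg => y; rewrite /shift_field /Phi /V /cfg_shift /= add0r.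
  by ring.
apply: (@le_trans _ _ (Ex (fun w => `|avgF s p k V x w| +
   `|avgF s p k (shift_field zeta Phi) x w| + `|m n|))).
  apply: Ex_le => [||w].
  - apply: Int_norm; rewrite (_ : avgF _ _ _ _ _ =
        (fun w => avgF s p k V x w + avgF s p k (shift_field zeta Phi) x w + m n)).
      by apply: IntD; [apply: IntD => //; exact: L2_int|exact: Int_cst].
    by apply/funext => w; exact: E.
  - by apply: IntD; [apply: IntD; apply: Int_norm => //; exact: L2_int|exact: Int_cst].
  - by rewrite E (le_trans (ler_normD _ _))// lerD2r ler_normD.
rewrite ExD; [|by apply: IntD; apply: Int_norm => //; exact: L2_int|exact: Int_cst].
rewrite ExD; [|exact: Int_norm|by apply: Int_norm; exact: L2_int].
rewrite Ex_cst; have := mr n; move: h1 h2 rn.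
by move: (Ex _) (Ex _) (r n) `|m n| => a b c f; lra.
Qed.

End ergodicL1.

(** * Inf-convolution and measurability *)

Lemma ptws_cvg (R : realType) (I : Type) (y : nat -> I -> R) (x : I -> R) :
  (forall j, y n j @[n --> \oo] --> x j) ->
  (y : nat -> {ptws I -> R}) @ \oo --> (x : {ptws I -> R}).
Proof.
move=> yx; apply/cvg_sup => j A.
rewrite (@nbhsE (initial_topology (fun f : I -> R => f j))) => -[B [[C oC <-] Cx] BA].
apply: filterS BA _; apply: (yx j); exact: open_nbhs_nbhs.
Qed.

Section lipschitz.
Context {R : realType} {I : countType}.
Implicit Types (L : seq I) (x y : I -> R) (G : (I -> R) -> R).

(** Exchanging x and y gives the other inequality. As L is a finite list, such a G depends on the
    coordinates in L only. *)
Definition lip L (K : R) G := forall x y, G x <= G y + K * \sum_(j <- L) `|x j - y j|.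

Lemma lip_dist L K G x y : lip L K G -> `|G x - G y| <= K * \sum_(j <- L) `|x j - y j|.
Proof.
move=> lG; rewrite ler_norml; apply/andP; split; last by rewrite lerBlDl lG.
rewrite lerNl opprB lerBlDl (le_trans (lG y x))//.
by under eq_bigr do rewrite distrC.
Qed.

Lemma lip_cvg L K G (xn : nat -> I -> R) x : lip L K G ->
  (forall j, j \in L -> xn n j @[n --> \oo] --> x j) -> G (xn n) @[n --> \oo] --> G x.
Proof.
move=> lG xx; apply/subr_cvg0; apply/norm_cvg0P.
have h : K * \sum_(j <- L) `|xn n j - x j| @[n --> \oo] --> 0.
  rewrite -[X in _ --> X](mulr0 K); apply: cvgMr.
  elim: L {lG} xx => [|j L IH] xx.
    rewrite (_ : (fun n => _) = (fun=> 0)); first exact: cvg_cst.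
    by apply/funext => n; rewrite big_nil.
  rewrite (_ : (fun n => _) = (fun n => `|xn n j - x j| + \sum_(i <- L) `|xn n i - x i|)).
    rewrite -[X in _ --> X](addr0 0); apply: cvgD.
      by apply/norm_cvg0P/subr_cvg0; apply: xx; rewrite mem_head.
    by apply: IH => i iL; apply: xx; rewrite in_cons iL orbT.
  by apply/funext => n; rewrite big_cons.
apply: (squeeze_cvgr _ (cvg_cst 0) h).
by apply: nearW => n; rewrite normr_ge0 lip_dist.
Qed.

(** The Lipschitz regularisation (Pasch-Hausdorff envelope) of f from below, with a penalty on the
    coordinates in L only. *)
Definition infconv f L (K : R) x : R :=
  inf [set f y + K * \sum_(j <- L) `|x j - y j| | y in [set: I -> R]].

Variables (f : (I -> R) -> R) (C : R).
Hypothesis fC : forall x, `|f x| <= C.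

Lemma infconv_lb L K x : 0 <= K -> forall y, - C <= f y + K * \sum_(j <- L) `|x j - y j|.
Proof.
move=> K0 y; have := fC y; rewrite ler_norml => /andP[h _].
by rewrite (le_trans h)// lerDl mulr_ge0// sumr_ge0.
Qed.

Lemma infconv_hasinf L K x : 0 <= K ->
  has_inf [set f y + K * \sum_(j <- L) `|x j - y j| | y in [set: I -> R]].
Proof.
move=> K0; split; first by exists (f x + K * \sum_(j <- L) `|x j - x j|), x.
by exists (- C) => _ [y _ <-]; exact: infconv_lb.
Qed.

Lemma infconv_le L K x y : 0 <= K ->
  infconv f L K x <= f y + K * \sum_(j <- L) `|x j - y j|.
Proof.
by move=> K0; apply: ge_inf; [exact: (infconv_hasinf L x K0).2|exists y].
Qed.

Lemma infconv_le_self L K x : 0 <= K -> infconv f L K x <= f x.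
Proof.
move=> K0; apply: le_trans (infconv_le L x x K0) _.
by rewrite big1 ?mulr0 ?addr0// => j _; rewrite subrr normr0.
Qed.

Lemma infconv_bounded L K x : 0 <= K -> `|infconv f L K x| <= C.
Proof.
move=> K0; rewrite ler_norml; apply/andP; split.
  apply: lb_le_inf; first exact: (infconv_hasinf L x K0).1.
  by move=> _ [y _ <-]; exact: infconv_lb.
by rewrite (le_trans (infconv_le_self L x K0))// (le_trans (ler_norm _)).
Qed.

Lemma infconv_lip L K : 0 <= K -> lip L K (infconv f L K).
Proof.
move=> K0 x y; rewrite -lerBlDr; apply: lb_le_inf.
  exact: (infconv_hasinf L y K0).1.
move=> _ [z _ <-]; rewrite lerBlDr -addrA -mulrDr.
apply: le_trans (infconv_le L x z K0) _; rewrite lerD2l ler_wpM2l// -big_split.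
by apply: ler_sum => j _ /=; rewrite addrC ler_distD.
Qed.

Definition coords n : seq I := pmap unpickle (iota 0 n).

Lemma coordsP j n : (pickle j < n)%N -> j \in coords n.
Proof. by move=> jn; rewrite mem_pmap -pickleK map_f// mem_iota. Qed.

(** Near-minimisers y_n pay a bounded penalty with factor n, so each coordinate of y_n tends to that
    of x; continuity of f along this sequence then closes the gap between the envelope and f. *)
Lemma infconv_cvg x : continuous (f : {ptws I -> R} -> R) ->
  infconv f (coords n) n%:R x @[n --> \oo] --> f x.
Proof.
move=> cf.
have n0 n : 0 <= n%:R :> R by [].
have q0 n : 0 < n.+1%:R^-1 :> R by [].
have /choice[y hy] : forall n, exists y : I -> R,
    f y + n%:R * \sum_(j <- coords n) `|x j - y j| < infconv f (coords n) n%:R x + n.+1%:R^-1.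
  move=> n; have [_ [y _ <-]] := inf_adherent (q0 n) (infconv_hasinf (coords n) x (n0 n)).
  by exists y.
have yj j : y n j @[n --> \oo] --> x j.
  apply/cvgrPdist_le => e e0; near=> n.
  have hn := hy n.
  have jn : (pickle j < n)%N by near: n; exact: nbhs_infty_gt.
  have np : 0 < n%:R :> R by rewrite ltr0n (leq_ltn_trans _ jn).
  have h1 : `|x j - y n j| <= \sum_(j <- coords n) `|x j - y n j|.
    by rewrite (big_rem j) ?coordsP//= lerDl sumr_ge0.
  (* The envelope is at most C, f is at least -C, and the slack 1/(n+1) is at most 1. *)
  have h2 : n%:R * `|x j - y n j| <= 2 * C + 1.
    apply: (@le_trans _ _ (n%:R * \sum_(j <- coords n) `|x j - y n j|)).
      by rewrite ler_wpM2l.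
    have := fC (y n); have := infconv_bounded (coords n) x (n0 n).
    rewrite !ler_norml => /andP[_ a1] /andP[a2 _].
    have : n.+1%:R^-1 <= 1 :> R by rewrite invf_le1// ler1n.
    by move: hn; move: (_ * _) (infconv _ _ _ _) (_^-1) a1 => u v w; lra.
  have h3 : (2 * C + 1) / e <= n%:R by near: n; exact: nbhs_infty_ger.
  rewrite -(ler_pM2l np) (le_trans h2)//.
  by rewrite -ler_pdivrMr.
have fy : f (y n) @[n --> \oo] --> f x.
  exact: (cvg_comp _ _ (ptws_cvg yj) (cf x)).
have lo : f (y n) - n.+1%:R^-1 @[n --> \oo] --> f x.
  by rewrite -[f x]subr0; apply: cvgB => //; exact: cvg_harmonic.
apply: (squeeze_cvgr _ lo (cvg_cst (f x))).
apply: nearW => n; rewrite infconv_le_self// andbT lerBlDr ltW//.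
apply: le_lt_trans (hy n); rewrite lerDl mulr_ge0// sumr_ge0.
Unshelve. all: by end_near. Qed.

End lipschitz.

Section measurability.
Context {R : realType} {I : countType} {dO : measure_display} {O : measurableType dO}.

Lemma measurable_floor_eq (f : O -> R) (z : int) : measurable_fun setT f ->
  measurable [set w | Num.floor (f w) = z].
Proof.
move=> mf; rewrite (_ : [set w | _] =
    [set w | z%:~R <= f w] `&` [set w | f w < (z + 1)%:~R]).
  by apply: measurableI; [exact: measurable_ge_set|exact: measurable_lt_set].
apply/seteqP; split=> w /=.
  by move=> <-; have /andP[] := floor_itv (f w).
by move=> [h1 h2]; apply: floor_def; rewrite h1.
Qed.

(** Rounding the coordinates in L down to multiples of 1/(k+1) leaves countably many values, so the
    rounded composite is measurable whatever G is; the Lipschitz bound passes to the limit in k. *)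
Lemma measurable_lip (L : seq I) K (G : (I -> R) -> R) (X : O -> I -> R) :
  lip L K G -> (forall j, measurable_fun setT (fun w => X w j)) ->
  measurable_fun setT (fun w => G (X w)).
Proof.
move=> lG mX.
pose m k w : seq int := [seq Num.floor (k.+1%:R * X w j) | j <- L].
have mm k l : measurable [set w | m k w = l].
  rewrite /m; elim: L l {lG m} => [|j L IH] [|z l].
  - by rewrite (_ : [set w | _] = setT)//; apply/seteqP; split.
  - by rewrite (_ : [set w | _] = set0)//; apply/seteqP; split.
  - by rewrite (_ : [set w | _] = set0)//; apply/seteqP; split.
  - rewrite (_ : [set w | _] = [set w | Num.floor (k.+1%:R * X w j) = z] `&`
        [set w | [seq Num.floor (k.+1%:R * X w j) | j <- L] = l]).
      by apply: measurableI => //; apply: measurable_floor_eq; exact: measurable_funM.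
    by apply/seteqP; split=> w /= [-> ->].
(* Coordinates outside L fall on the default of [nth] and become 0, which G does not see. *)
pose H k (l : seq int) (j : I) : R := (nth 0 l (index j L))%:~R / k.+1%:R.
apply: (@measurable_fun_cvg _ _ _ _ (fun k w => G (H k (m k w)))) => [k|w _].
  move=> _ B mB; rewrite setTI.
  rewrite (_ : _ @^-1` B = \bigcup_(l : seq int) (if `[< B (G (H k l)) >] then
      [set w | m k w = l] else set0)).
    apply: countable_bigcupT_measurable; first exact: countableP.
    by move=> l; case: ifP.
  apply/seteqP; split=> w /=.
    by move=> h; exists (m k w) => //; rewrite asboolT.
  by move=> [l _]; case: ifPn => // /asboolP h /= ->.
apply: (lip_cvg lG) => j jL.
have E k : H k (m k w) j = (Num.floor (k.+1%:R * X w j))%:~R / k.+1%:R.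
  by rewrite /H /m (nth_map j) ?index_mem// nth_index.
have lo : X w j - k.+1%:R^-1 @[k --> \oo] --> X w j.
  by rewrite -[X in _ --> X]subr0; apply: cvgB; [exact: cvg_cst|exact: cvg_harmonic].
apply: (squeeze_cvgr _ lo (cvg_cst (X w j))).
apply: nearW => k; rewrite E.
have k0 : 0 < k.+1%:R :> R by [].
have /andP[h1 h2] := floor_itv (k.+1%:R * X w j).
apply/andP; split; last by rewrite ler_pdivrMr// [leRHS]mulrC.
rewrite ler_pdivlMr// mulrBl mulVf ?gt_eqF// [X w j * _]mulrC.
by move: h2; rewrite intrD; lra.
Qed.

(** Where the sequence diverges, [limn] is the default [point]; the convergence set is measurable by
    the Cauchy criterion, and off it the sequence is replaced by that constant. *)
Lemma measurable_limn (a : nat -> O -> R) : (forall n, measurable_fun setT (a n)) ->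
  measurable_fun setT (fun w => limn (fun n => a n w)).
Proof.
move=> ma; pose D := [set w | cvgn (fun n => a n w)].
have mD : measurable D.
  rewrite (_ : D = \bigcap_(r : nat) \bigcup_(n : nat) \bigcap_(m in [set m | (n <= m)%N])
      [set w | `|a n w - a m w| < r.+1%:R^-1]).
    apply: bigcap_measurableType => r _; apply: bigcup_measurable => n _.
    apply: bigcap_measurableType => m _; apply: measurable_lt_set.
    by apply: measurableT_comp => //; exact: measurable_funB.
  apply/seteqP; split=> w.
    move=> cw r _.
    have cw' : a n w @[n --> \oo] --> limn (fun n => a n w) by exact: cw.
    have e0 : 0 < (r.+1%:R^-1 / 2 : R) by rewrite divr_gt0.
    move/cvgrPdist_lt : cw' => /(_ _ e0)[n _ hn]; exists n => // m /= nm.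
    have := hn n (leqnn n); have := hn m nm; rewrite /=; set l := limn _ => h1 h2.
    rewrite (_ : a n w - a m w = (l - a m w) - (l - a n w)); last by ring.
    apply: le_lt_trans (ler_normB _ _) _.
    by move: h1 h2; move: `|l - a m w| `|l - a n w| (_^-1) => u v q; lra.
  move=> h; apply: cauchy_cvg; apply: cauchy_exP => e e0.
  have [r hr] : exists r, (r.+1%:R^-1 : R) < e.
    have [N _ /(_ N (leqnn N))] := near_infty_natSinv_lt (PosNum e0).
    by exists N.
  have [n _ hn] := h r Logic.I; exists (a n w); exists n => // m /= nm.
  by rewrite /ball /=; apply: lt_trans hr; exact: hn.
apply: (@measurable_fun_cvg _ _ _ _ (fun n w => if w \in D then a n w else point)) => [n|w _].
  apply: measurable_fun_ifT => //; apply: (measurable_fun_bool true); rewrite setTI.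
  rewrite (_ : _ @^-1` _ = D)//.
  by apply/seteqP; split=> v; [exact: set_mem|exact: mem_set].
have [wD|wD] := boolP (w \in D).
  exact: (set_mem wD).
rewrite dvgP; first exact: cvg_cst.
by move=> h; move/negP: wD; apply; exact: mem_set.
Qed.

End measurability.

(** * Weak convergence *)

Section weak_convergence.
Context {R : realType} {d : nat} {dO : measure_display} {O : measurableType dO}.
Variable P : probability O R.
Notation Ex := (Ex P). Notation Int := (Int P).
Variables (X : nat -> O -> cfg R d) (Y : O -> cfg R d).
Hypotheses (mX : forall n j, measurable_fun setT (fun w => X n w j))
  (mY : forall j, measurable_fun setT (fun w => Y w j)).
Hypothesis XY : forall L (K : R) (G : cfg R d -> R) (C : R), 0 <= K -> lip L K G ->
  (forall c, `|G c| <= C) -> Ex (fun w => G (X n w)) @[n --> \oo] --> Ex (fun w => G (Y w)).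

(** Continuity refers to the product topology and measurability to coordinates; inf-convolutions
    over finitely many coordinates join the two. *)
Lemma measurable_continuous_fam (f : {ptws (site d * 'I_d) -> R} -> R) (C : R) (Z : O -> cfg R d) :
  continuous f -> (forall c, `|f c| <= C) ->
  (forall j, measurable_fun setT (fun w => Z w j)) -> measurable_fun setT (fun w => f (Z w)).
Proof.
move=> cf fC mZ.
apply: (@measurable_fun_cvg _ _ _ _
  (fun n w => infconv f (coords n) n%:R (Z w))) => [n|w _].
  apply: (@measurable_lip _ _ _ _ (coords n) n%:R (infconv f (coords n) n%:R)) => //.
  exact: (infconv_lip fC).
exact: (infconv_cvg fC cf).
Qed.

(** An envelope g_m below f is fixed with E g_m(Y) within e/2 of E f(Y); only then n grows, and E
    f(X_n) >= E g_m(X_n). *)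
Lemma weak_liminf (f : {ptws (site d * 'I_d) -> R} -> R) (C e : R) :
  continuous f -> (forall c, `|f c| <= C) -> 0 < e ->
  \forall n \near \oo, Ex (fun w => f (Y w)) - e <= Ex (fun w => f (X n w)).
Proof.
move=> cf fC e0.
pose g n := infconv f (coords n) n%:R.
have n0 n : 0 <= n%:R :> R by [].
have lg n : lip (coords n) n%:R (g n) by apply: (infconv_lip fC).
have gC n c : `|g n c| <= C by apply: (infconv_bounded fC).
have mg n (Z : O -> cfg R d) : (forall j, measurable_fun setT (fun w => Z w j)) ->
    measurable_fun setT (fun w => g n (Z w)).
  by move=> mZ; exact: (measurable_lip (lg n)).
have mf (Z : O -> cfg R d) : (forall j, measurable_fun setT (fun w => Z w j)) ->
    measurable_fun setT (fun w => f (Z w)) by exact: measurable_continuous_fam fC.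
have gY : Ex (fun w => g n (Y w)) @[n --> \oo] --> Ex (fun w => f (Y w)).
  apply: (Ex_cvg (C := C)).
  - by move=> n; exact: mg.
  - exact: mf.
  - by move=> n w; exact: gC.
  - by apply: aeW => w; exact: (infconv_cvg fC cf).
have e2 : 0 < e / 2 by rewrite divr_gt0.
move/cvgrPdist_le : gY => /(_ _ e2)[m _ /(_ m (leqnn m)) /= hm].
have /cvgrPdist_le /(_ _ e2)[N _ hN] := XY (n0 m) (lg m) (gC m).
exists N => // n /= /hN /=.
have le : Ex (fun w => g m (X n w)) <= Ex (fun w => f (X n w)).
  apply: Ex_le => [||w].
  - by apply: (@Int_bounded _ _ _ P _ C) => //; exact: mg.
  - by apply: (@Int_bounded _ _ _ P _ C) => //; exact: mf.
  - exact: (infconv_le_self fC _ _ (n0 m)).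
move: hm le; rewrite !ler_norml => + + /andP[_ +].
by move=> /andP[_ ]; move: (Ex _) (Ex _) (Ex _) (Ex _) => a b c x; lra.
Qed.

Lemma weak_conv_lip : weak_conv_laws P X Y.
Proof.
move=> f cf [C fC].
have If (Z : O -> cfg R d) : (forall j, measurable_fun setT (fun w => Z w j)) ->
    Int (fun w => f (Z w)).
  move=> mZ; apply: (@Int_bounded _ _ _ P _ C) => //.
  exact: measurable_continuous_fam fC mZ.
rewrite (Ex_EFin (If _ mY)).
rewrite (_ : (fun t => _) = (fun t => (Ex (fun w => f (X t w)))%:E)); last first.
  by apply/funext => t; rewrite (Ex_EFin (If _ (mX t))).
suff h : Ex (fun w => f (X t w)) @[t --> \oo] --> Ex (fun w => f (Y w)).
  by apply: cvg_comp h _; exact: cvg_id.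
apply/cvgrPdist_le => e e0.
(* The matching upper bound is the lower bound for -f. *)
have cNf : continuous ((fun c => - f c) : {ptws (site d * 'I_d) -> R} -> R).
  by move=> c; exact: (@cvgN _ _ _ _ _ (f : {ptws (site d * 'I_d) -> R} -> R) _ (cf c)).
have NfC c : `|- f c| <= C by rewrite normrN.
have EN (Z : O -> cfg R d) : (forall j, measurable_fun setT (fun w => Z w j)) ->
    Ex (fun w => - f (Z w)) = - Ex (fun w => f (Z w)).
  move=> mZ; rewrite -mulN1r -(ExZ (-1) (If _ mZ)).
  by congr (Ex _); apply/funext => w; rewrite mulN1r.
have := weak_liminf cNf NfC e0; apply: filterS2 (weak_liminf cf fC e0) => n.
rewrite !EN// ler_norml; move: (Ex _) (Ex _) => a b h1 h2.
by apply/andP; split; lra.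
Qed.

End weak_convergence.

(** * Unfolding the recursion and passing to the limit *)

Section conclusion.
Context {R : realType} {d : nat}.
Variables (s : seq (site d)) (p : site d -> R).
Hypothesis sp : ker_on s p.

(** The array [c] is indexed by the age k of the noise: with xi_(t-k) this is S_t, with xi_(-k) the
    t-th partial sum of [Delta0]. *)
Definition noise_sum t (c : nat * site d -> R) : cfg R d := fun j =>
  \sum_(k < t) (iter k (avg s p) (fun z => c (k : nat, z)) j.1 -
                iter k (avg s p) (fun z => c (k : nat, z)) (j.1 - unit_vec j.2)).

Lemma avg_sum n (g : nat -> site d -> R) x :
  avg s p (fun y => \sum_(k < n) g k y) x = \sum_(k < n) avg s p (g k) x.
Proof.
rewrite /avg exchange_big; apply: eq_bigr => z _ /=.
by rewrite mulr_sumr.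
Qed.

Lemma harmonic_avg (u : 'I_d -> site d -> R) i x : p_harmonic p u ->
  avg s p (u i) x = u i x.
Proof.
move=> hu; rewrite -[RHS](hu i x) -(fsum_avg _ _ sp).
rewrite -(fsum_shift (fun z => p z * u i (x + z)) x).
by congr fsum; apply/funext => z; rewrite [x + _]addrC subrK.
Qed.

Lemma process_unfold (xi : int -> site d -> R) (eta : nat -> cfg R d)
    (u : 'I_d -> site d -> R) (zeta : cfg R d) :
  (forall t x i, eta t.+1 (x, i) =
     fsum (fun z => p z * eta t (x + z, i)) + xi (t.+1)%:Z x
     - xi (t.+1)%:Z (x - unit_vec i)) ->
  p_harmonic p u -> (forall j, eta 0%N j = u j.2 j.1 + zeta j) ->
  forall t j, eta t j = u j.2 j.1 + noise_sum t (fun kz => xi (t%:Z - kz.1%:Z) kz.2) j +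
    iter t (avg s p) (fun y => zeta (y, j.2)) j.1.
Proof.
move=> rec hu e0 t [x i] /=; elim: t x => [|t IH] x.
  by rewrite e0 /noise_sum big_ord0 addr0.
rewrite rec (fsum_avg (fun y => eta t (y, i)) x sp).
rewrite (_ : (fun y => eta t (y, i)) = (fun y => u i y +
    noise_sum t (fun kz => xi (t%:Z - kz.1%:Z) kz.2) (y, i) +
    iter t (avg s p) (fun y => zeta (y, i)) y)); last by apply/funext => y.
(* The term k = 0 is the fresh noise; the others have age raised by one, and (t+1) - (k+1) = t -
   k. *)
rewrite !avgD harmonic_avg//= /noise_sum big_ord_recl /= subr0.
rewrite (avg_sum t (fun k y => iter k (avg s p) (fun z => xi (t%:Z - k%:Z) z) y -
   iter k (avg s p) (fun z => xi (t%:Z - k%:Z) z) (y - unit_vec i))).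
set S1 := \sum_(_ < t) _; set S2 := \sum_(_ < t) _.
have -> : S1 = S2.
  apply: eq_bigr => k _; rewrite avgB /bump leq0n add1n.
  rewrite (avg_shift _ _ _ (- unit_vec i)) /=.
  by have -> : t.+1%:Z - k.+1%:Z = t%:Z - k%:Z by rewrite !intS opprD addrACA subrr add0r.
by ring.
Qed.

Context {dO : measure_display} {O : measurableType dO}.
Variable P : probability O R.
Notation Ex := (Ex P). Notation Int := (Int P).
Hypothesis ap : strongly_aperiodic p.
Variables (xi : int -> site d -> O -> R) (u : 'I_d -> site d -> R).
Hypothesis nxi : iid_noise P xi.

Let X (j : int * site d) := xi j.1 j.2.
Let past_noise (j : nat * site d) w := xi (- j.1%:Z) j.2 w.

Lemma measurable_noise_sum dT (T : measurableType dT) t (c : T -> nat * site d -> R) j :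
  (forall i, measurable_fun setT (fun w => c w i)) ->
  measurable_fun setT (fun w => noise_sum t (c w) j).
Proof.
move=> mc; apply: measurable_sum => k; apply: measurable_funB;
  exact: (@measurable_iter_avg _ _ _ _ s p k (fun w z => c w (k : nat, z))).
Qed.

Lemma Delta0_noise_sum w j :
  Delta0 p xi w j = limn (fun n => noise_sum n (past_noise ^~ w) j).
Proof.
rewrite /Delta0; congr (lim (_ @ \oo)); apply/funext => n.
by apply: eq_bigr => k _; rewrite (fsum_pstepB _ (fun z => xi (- k%:Z) z w) _ _ sp).
Qed.

Lemma noise_sum_cvg :
  {ae P, forall w, forall j, noise_sum n (past_noise ^~ w) j @[n --> \oo] --> Delta0 p xi w j}.
Proof.
have [mxi [ixi [dxi Lxi]]] := nxi.
have inj : injective (fun j : nat * site d => (- j.1%:Z, j.2)).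
  by move=> [k z] [k' z'] [] /oppr_inj [] -> ->.
have L2p j : L2 P (past_noise j) by split; [exact: mxi|exact: (Lxi _ _).2.2].
have ip : mutually_independent P past_noise := mutually_independent_inj inj ixi.
have dp : id_distributed P past_noise by move=> i j B mB; exact: dxi.
have p0 j : Ex (past_noise j) = 0 by rewrite /Ex /Rintegral (Lxi _ _).2.1.
apply: ae_forall_countable => j.
have := noise_series_cvg sp ap L2p ip dp p0 j.1 (j.1 - unit_vec j.2).
by apply: filterS => w h; rewrite Delta0_noise_sum; exact: h.
Qed.

(** The two arrays read the noise by age from time t and from time 0, both injectively, so they have
    the same law. *)
Lemma noise_sum_law t (G : cfg R d -> R) L K : lip L K G ->
  Ex (fun w => G (fun j => u j.2 j.1 +
     noise_sum t (fun kz => xi (t%:Z - kz.1%:Z) kz.2 w) j)) =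
  Ex (fun w => G (fun j => u j.2 j.1 + noise_sum t (past_noise ^~ w) j)).
Proof.
move=> lG; have [mxi [ixi [dxi _]]] := nxi.
apply: (iid_reindex_integral (X := X)
  (h := fun kz : nat * site d => (t%:Z - kz.1%:Z, kz.2))
  (h' := fun kz : nat * site d => (- kz.1%:Z, kz.2))
  (F := fun c => G (fun j => u j.2 j.1 + noise_sum t c j))).
- by move=> j; exact: mxi.
- exact: ixi.
- by move=> i j B mB; exact: dxi.
- by move=> [k z] [k' z'] [] /addrI /oppr_inj [] -> ->.
- by move=> [k z] [k' z'] [] /oppr_inj [] -> ->.
- apply: (@measurable_lip _ _ _ (g_sigma_algebraType
    (coord_events (fun (j : nat * site d) (c : nat * site d -> R) => c j)))
    L K G (fun c j => u j.2 j.1 + noise_sum t c j)) => // j.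
  apply: measurable_funD => //; apply: (@measurable_noise_sum _ (g_sigma_algebraType
    (coord_events (fun (j : nat * site d) (c : nat * site d -> R) => c j))) t (fun c => c)) => i.
  exact: measurable_coord.
Qed.

End conclusion.

Theorem theorem2p5 (R : realType) (d : nat) (p : site d -> R)
  (dO : measure_display) (O : measurableType dO) (P : probability O R)
  (xi : int -> site d -> O -> R) (eta : nat -> O -> cfg R d)
  (u : 'I_d -> site d -> R) (zeta : O -> cfg R d) :
  is_rw_kernel p -> strongly_aperiodic p -> iid_noise P xi ->
  (forall t w x i, eta t.+1 w (x, i) =
     fsum (fun z => p z * eta t w (x + z, i)) + xi (t.+1)%:Z x w
     - xi (t.+1)%:Z (x - unit_vec i) w) ->
  independent_families P (fun j : nat * site d => xi (j.1.+1)%:Z j.2)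
                         (fun (j : site d * 'I_d) w => eta 0%N w j) ->
  p_harmonic p u ->
  (forall j, measurable_fun setT (fun w => zeta w j)) ->
  shift_invariant_law P zeta -> shift_ergodic_law P zeta ->
  (forall j, P.-integrable setT (fun w => (zeta w j)%:E) /\
             (\int[P]_w (zeta w j)%:E = 0)%E) ->
  (forall w j, eta 0%N w j = u j.2 j.1 + zeta w j) ->
  weak_conv_laws P eta (fun w j => u j.2 j.1 + Delta0 p xi w j).
Proof.
move=> /rw_kernel_support[s sp] ap nxi rec _ hu mz iz ez Iz eta0.
have mxi := nxi.1.
pose B t w j := u j.2 j.1 + noise_sum s p t (fun kz => xi (t%:Z - kz.1%:Z) kz.2 w) j.
pose A t j w := avgF s p t (fun y w => zeta w (y, j.2)) j.1 w.
have etaE t w : eta t w = (fun j => B t w j + A t j w).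
  apply/funext => j.
  exact: (process_unfold sp (xi := fun t x => xi t x w) (eta := fun t => eta t w)
    (fun t x i => rec t w x i) hu (eta0 w)).
have Iz' j : Int P (fun w => zeta w j) by exact: (Iz j).1.
have z0 j : Ex P (fun w => zeta w j) = 0 by rewrite /Ex /Rintegral (Iz j).2.
have mA t j : measurable_fun setT (A t j).
  exact: (@measurable_iter_avg _ _ _ _ s p t (fun w y => zeta w (y, j.2))).
have IA t j : Int P (A t j).
  have := avgF_L1 sp (r := Ex P (fun w => `|zeta w (0, j.2)|)) t j.1
    (fun y => Iz' (y, j.2)).
  by case=> // y; rewrite -(shift_law_Ex mz iz (Phi := fun c => `|c (0, j.2)|) y)
    /cfg_shift /= ?add0r//; apply: measurableT_comp => //; exact: measurable_coord.
have mB t j : measurable_fun setT (fun w => B t w j).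
  apply: measurable_funD => //.
  by apply: (@measurable_noise_sum _ _ s p _ _ t
      (fun w kz => xi (t%:Z - kz.1%:Z) kz.2 w)) => i; exact: mxi.
have mD t j : measurable_fun setT (fun w => u j.2 j.1 +
    noise_sum s p t (fun kz => xi (- kz.1%:Z) kz.2 w) j).
  apply: measurable_funD => //.
  by apply: (@measurable_noise_sum _ _ s p _ _ t
      (fun w kz => xi (- kz.1%:Z) kz.2 w)) => i; exact: mxi.
have meta t j : measurable_fun setT (fun w => eta t w j).
  rewrite (_ : (fun w => _) = (fun w => B t w j + A t j w)).
    exact: measurable_funD.
  by apply/funext => w; rewrite etaE.
have mY j : measurable_fun setT (fun w => u j.2 j.1 + Delta0 p xi w j).
  apply: measurable_funD => //; rewrite (_ : (fun w => _) =
    (fun w => limn (fun n => noise_sum s p n (fun kz => xi (- kz.1%:Z) kz.2 w) j))).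
    apply: measurable_limn => n.
    by apply: (@measurable_noise_sum _ _ s p _ _ n
      (fun w kz => xi (- kz.1%:Z) kz.2 w)) => i; exact: mxi.
  by apply/funext => w; rewrite (Delta0_noise_sum sp).
apply: weak_conv_lip => // L K G C K0 lG GC.
have IG (Z : O -> cfg R d) : (forall j, measurable_fun setT (fun w => Z w j)) ->
    Int P (fun w => G (Z w)).
  by move=> mZ; apply: (@Int_bounded _ _ _ P _ C) => //; exact: measurable_lip lG mZ.
(* Dropping the averaged [zeta] from [eta t] changes G by at most this amount in mean. *)
have AL : K * \sum_(j <- L) Ex P (fun w => `|A t j w|) @[t --> \oo] --> 0.
  rewrite -[X in _ --> X](mulr0 K); apply: cvgMr.
  elim: L {lG} => [|j L IH].
    rewrite (_ : (fun n => _) = (fun=> 0)); first exact: cvg_cst.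
    by apply/funext => n; rewrite big_nil.
  rewrite (_ : (fun n => _) = (fun t => Ex P (fun w => `|A t j w|) +
      \sum_(i <- L) Ex P (fun w => `|A t i w|))).
    rewrite -[X in _ --> X](addr0 0); apply: cvgD => //.
    exact: (ergodic_avg_L1 sp ap mz iz ez Iz' z0 j.1 j.2).
  by apply/funext => n; rewrite big_cons.
(* At each fixed t the noise is replaced by its copy read from time 0, whose sums converge almost
   surely; bounded convergence then applies. *)
have hD : Ex P (fun w => G (B t w)) @[t --> \oo] -->
    Ex P (fun w => G (fun j => u j.2 j.1 + Delta0 p xi w j)).
  rewrite (_ : (fun t => _) = (fun t => Ex P (fun w => G (fun j => u j.2 j.1 +
     noise_sum s p t (fun kz => xi (- kz.1%:Z) kz.2 w) j)))); last first.
    by apply/funext => t; exact: (noise_sum_law s p u nxi t lG).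
  apply: (Ex_cvg (C := C)).
  - by move=> t; exact: measurable_lip lG (mD t).
  - exact: measurable_lip lG mY.
  - by [].
  - apply: filterS (noise_sum_cvg sp ap nxi) => w h.
    by apply: (lip_cvg lG) => j _; apply: cvgD; [exact: cvg_cst|exact: h].
rewrite -[X in _ --> X]addr0.
rewrite (_ : (fun t => _) = (fun t => Ex P (fun w => G (B t w)) +
   (Ex P (fun w => G (eta t w)) - Ex P (fun w => G (B t w))))); last first.
  by apply/funext => t; ring.
apply: cvgD => //; apply/norm_cvg0P.
apply: (squeeze_cvgr _ (cvg_cst 0) AL); apply: nearW => t.
rewrite normr_ge0 /= -ExB; [|exact: IG|exact: IG].
apply: le_trans (Ex_norm _) _; first by apply: IntB; exact: IG.
have IS : Int P (fun w => \sum_(j <- L) `|A t j w|).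
  by apply: Int_sum => j _; exact: Int_norm.
rewrite -(@Ex_sum _ _ _ P _ L (fun j w => `|A t j w|)); last by move=> j _; exact: Int_norm.
rewrite -ExZ//; apply: Ex_le => [||w].
- by apply: Int_norm; apply: IntB; exact: IG.
- exact: IntZ.
- apply: le_trans (lip_dist _ _ lG) _; rewrite ler_wpM2l//.
  by apply: ler_sum => j _; rewrite etaE addrC addKr.
Qed.
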